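(* Let $\gamma_1,\gamma_2,\gamma_3,\delta_1,\delta_2,\delta_3,x,y\in\mathbb{C}$ with $\operatorname{Re}\delta_1>\operatorname{Re}\gamma_3>0$, and let $\alpha_1,\dots,\alpha_4,\beta_1,\dots,\beta_4$ be positive real numbers with $\beta_3-\beta_2>0$. Then $$D_1\left(\begin{matrix}\gamma_1,\alpha_1,\beta_1;\gamma_2,\alpha_2;\gamma_3,\beta_2;\\ \delta_1,\alpha_3,\beta_3;\delta_2,\alpha_4;\delta_3,\beta_4;\end{matrix}\left|\begin{matrix}x\\ y\end{matrix}\right.\right)=\frac{1}{\Gamma(\gamma_3)}\int_0^1\xi^{\gamma_3-1}(1-\xi)^{\delta_1-\gamma_3-1}$$ $$\times E_2\left(\begin{matrix}\gamma_1,\alpha_1,\beta_1;\gamma_2,\alpha_2;\\ \delta_1-\gamma_3,\alpha_3,\beta_3-\beta_2;\delta_2,\alpha_4;\delta_3,\beta_4;\end{matrix}\left|\begin{matrix}x(1-\xi)^{\alpha_3}\\ y\,\xi^{\beta_2}(1-\xi)^{\beta_3-\beta_2}\end{matrix}\right.\right)d\xi.$$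
   Context: $(\gamma)_\lambda=\Gamma(\gamma+\lambda)/\Gamma(\gamma)$ for $\gamma\in\mathbb{C}$ and real $\lambda\ge0$. For complex $\gamma_i,\delta_i,x,y$ and positive real $\alpha_i,\beta_i$, $$D_1\left(\begin{matrix}\gamma_1,\alpha_1,\beta_1;\gamma_2,\alpha_2;\gamma_3,\beta_2;\\ \delta_1,\alpha_3,\beta_3;\delta_2,\alpha_4;\delta_3,\beta_4;\end{matrix}\left|\begin{matrix}x\\ y\end{matrix}\right.\right)=\sum_{m,n=0}^{\infty}\frac{(\gamma_1)_{\alpha_1 m+\beta_1 n}(\gamma_2)_{\alpha_2 m}(\gamma_3)_{\beta_2 n}}{\Gamma(\delta_1+\alpha_3 m+\beta_3 n)}\frac{x^m}{\Gamma(\delta_2+\alpha_4 m)}\frac{y^n}{\Gamma(\delta_3+\beta_4 n)},$$ $$E_2\left(\begin{matrix}\gamma_1,\alpha_1,\beta_1;\gamma_2,\alpha_2;\\ \delta_1,\alpha_3,\beta_2;\delta_2,\alpha_4;\delta_3,\beta_3;\end{matrix}\left|\begin{matrix}x\\ y\end{matrix}\right.\right)=\sum_{m,n=0}^{\infty}\frac{(\gamma_1)_{\alpha_1 m+\beta_1 n}(\gamma_2)_{\alpha_2 m}}{\Gamma(\delta_1+\alpha_3 m+\beta_2 n)}\frac{x^m}{\Gamma(\delta_2+\alpha_4 m)}\frac{y^n}{\Gamma(\delta_3+\beta_3 n)}.$$ The functions are considered at arguments in the region of absolute convergence of their defining series. *)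

(* Defs.v *)
From HB Require Import structures.
From mathcomp Require Import all_boot all_order all_algebra.
From mathcomp Require Import all_classical all_reals all_analysis.
From mathcomp Require Export complex.

Set Implicit Arguments.
Unset Strict Implicit.
Unset Printing Implicit Defensive.

Import Order.TTheory GRing.Theory Num.Theory.
Import numFieldNormedType.Exports.
Import complex.

Local Open Scope classical_set_scope.
Local Open Scope ring_scope.
Local Open Scope complex_scope.

Section ComplexAnalysis.
Variable R : realType.
Implicit Types (z : R[i]) (t : R) (D : set R) (f : R -> R[i]).

Definition cexp z : R[i] :=
  (expR (Re z))%:C * (cos (Im z) +i* sin (Im z)).

(* The principal power t ^ z, used for real t > 0 only. *)
Definition cpow t z : R[i] := cexp (z * (ln t)%:C).

Definition cintegrable D f : Prop :=
  (@lebesgue_measure R).-integrable D (fun t => (Re (f t))%:E) /\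
  (@lebesgue_measure R).-integrable D (fun t => (Im (f t))%:E).

Definition cintegral D f : R[i] :=
  Rintegral (@lebesgue_measure R) D (fun t => Re (f t)) +i*
  Rintegral (@lebesgue_measure R) D (fun t => Im (f t)).

(* Absolute convergence of the double series with terms a m n; the norm of
   R[i] takes its values in R[i], hence the real part. *)
Definition abs_summable2 (a : nat -> nat -> R[i]) : Prop :=
  (\esum_(p in [set: nat * nat]) (Re `|a p.1 p.2|)%:E < +oo)%E.

(* The sum of a double series, as the limit of its square partial sums. It is
   only used under abs_summable2, where the order of summation is irrelevant.
   The topology induced by the norm is carried by R[i]^o. *)
Definition series2 (a : nat -> nat -> R[i]) : R[i] :=
  limn (fun N : nat =>
    (\sum_(0 <= m < N) \sum_(0 <= n < N) a m n) : R[i]^o).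

End ComplexAnalysis.

Section Gamma.
Variable R : realType.
Implicit Types (z g : R[i]) (l : R).

Definition Gamma_integral z : R[i] :=
  cintegral `]0, +oo[ (fun t : R => cpow t (z - 1) * (expR (- t))%:C).

(* A number of unit shifts that brings z into the right half-plane. *)
Definition Gamma_shift z : nat :=
  if 0 < Re z then 0%N else (Num.truncn (- Re z)).+1.

(* Euler's integral for Re z > 0, continued to the left by
   Gamma z = Gamma (z + n) / (z (z + 1) ... (z + n - 1)). At a pole
   z = 0, -1, -2, ... the denominator vanishes, so that Gamma z = 0 and hence
   (Gamma z)^-1 = 0, which is the value of the entire function 1 / Gamma. *)
Definition Gamma z : R[i] :=
  Gamma_integral (z + (Gamma_shift z)%:R) /
  \prod_(0 <= j < Gamma_shift z) (z + j%:R).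

(* (g)_l = Gamma (g + l) / Gamma g. When g is a pole of Gamma, the quotient is
   extended by continuity in g; e.g. for g = - k and l a natural number this
   gives the rising factorial g (g + 1) ... (g + l - 1). The quotient has no
   value when g + l is a pole but g is not; the term is then 0. *)
Definition poch g l : R[i] :=
  if `[< exists k : nat, g = - k%:R >]
  then lim ((Gamma (z + l%:C) / Gamma z : R[i]^o) @[z --> (g : R[i]^o)^'])
  else Gamma (g + l%:C) / Gamma g.

End Gamma.

Section HypergeometricFunctions.
Variable R : realType.
Implicit Types (g d x y : R[i]) (a b : R).

Definition D1_term g1 a1 b1 g2 a2 g3 b2 d1 a3 b3 d2 a4 d3 b4 x y
    (m n : nat) : R[i] :=
  poch g1 (a1 * m%:R + b1 * n%:R) * poch g2 (a2 * m%:R) * poch g3 (b2 * n%:R)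
    / Gamma (d1 + (a3 * m%:R + b3 * n%:R)%:C)
  * (x ^+ m / Gamma (d2 + (a4 * m%:R)%:C))
  * (y ^+ n / Gamma (d3 + (b4 * n%:R)%:C)).

Definition D1_cvg g1 a1 b1 g2 a2 g3 b2 d1 a3 b3 d2 a4 d3 b4 x y : Prop :=
  abs_summable2 (D1_term g1 a1 b1 g2 a2 g3 b2 d1 a3 b3 d2 a4 d3 b4 x y).

Definition D1 g1 a1 b1 g2 a2 g3 b2 d1 a3 b3 d2 a4 d3 b4 x y : R[i] :=
  series2 (D1_term g1 a1 b1 g2 a2 g3 b2 d1 a3 b3 d2 a4 d3 b4 x y).

Definition E2_term g1 a1 b1 g2 a2 d1 a3 b2 d2 a4 d3 b3 x y
    (m n : nat) : R[i] :=
  poch g1 (a1 * m%:R + b1 * n%:R) * poch g2 (a2 * m%:R)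
    / Gamma (d1 + (a3 * m%:R + b2 * n%:R)%:C)
  * (x ^+ m / Gamma (d2 + (a4 * m%:R)%:C))
  * (y ^+ n / Gamma (d3 + (b3 * n%:R)%:C)).

Definition E2_cvg g1 a1 b1 g2 a2 d1 a3 b2 d2 a4 d3 b3 x y : Prop :=
  abs_summable2 (E2_term g1 a1 b1 g2 a2 d1 a3 b2 d2 a4 d3 b3 x y).

Definition E2 g1 a1 b1 g2 a2 d1 a3 b2 d2 a4 d3 b3 x y : R[i] :=
  series2 (E2_term g1 a1 b1 g2 a2 d1 a3 b2 d2 a4 d3 b3 x y).

End HypergeometricFunctions.

(* Main.v *)
Require Import Defs.
From mathcomp Require Import all_boot all_order all_algebra.
From mathcomp Require Import all_classical all_reals all_analysis.
From mathcomp Require Import complex.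
From mathcomp Require Import measurable_realfun ring lra.

(** Expanding E2 under the integral sign, the (m, n) term of the integrand is a
constant times t^(p-1) (1-t)^(q-1) with p = g3 + b2 n and
q = d1 - g3 + a3 m + (b3 - b2) n. Euler's formula
B(p, q) = Gamma p Gamma q / Gamma (p + q) turns its integral into Gamma g3
times the (m, n) term of D1 (p + q = d1 + a3 m + b3 n), so the theorem is the
exchange of a double sum and an integral.

Written Gamma p Gamma q = Gamma (p + q) B(p, q), Euler's formula equates the two
iterated integrals of s^(p-1) e^(-s) (u-s)^(q-1) e^(s-u), so it is an instance of
Fubini's theorem (Gamma_integralM). The same computation on moduli, where Tonelli's theorem
applies without any integrability, gives beforehand the finiteness of the Beta
integral (gamma_massM, beta_mass_lty).

The exchange requires the sum of the integrals of the moduli to be finite,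
whereas the absolute convergence of D1 is about the moduli of the integrals.
Here the imaginary parts of p and q do not depend on m and n, and along a
vertical line |Gamma z| >= c Gamma (Re z) with c > 0 (Gamma_integral_ge);
together with |Gamma z| <= Gamma (Re z) this gives B(Re p, Re q) <= K |B(p, q)|
with K independent of m and n (beta_mass_le). Dominated convergence along the
square partial sums concludes (ccvg_cintegral_series). The lower bound also
shows that Gamma has no zero in the right half-plane, without which the terms
of E2 could not be recovered from those of D1. *)

Set Implicit Arguments.
Unset Strict Implicit.
Unset Printing Implicit Defensive.

Import Order.TTheory GRing.Theory Num.Theory.
Import numFieldNormedType.Exports.
Local Open Scope classical_set_scope.
Local Open Scope ring_scope.
Local Open Scope complex_scope.

(** * Modulus, exponential and principal powers *)

Section complex_algebra.
Context {R : realType}.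
Implicit Types (z w : R[i]) (t s r : R).

Notation normc := Normc.normc.

Lemma normr_normc z : `|z| = (normc z)%:C.
Proof. by case: z. Qed.

Lemma normc_ge0 z : 0 <= normc z.
Proof. by case: z => a b /=; rewrite sqrtr_ge0. Qed.

Lemma ler_norm_Re z : `|complex.Re z| <= normc z.
Proof.
case: z => a b /=; rewrite -sqrtr_sqr ler_sqrt ?addr_ge0 ?sqr_ge0//.
by rewrite lerDl sqr_ge0.
Qed.

Lemma ler_norm_Im z : `|complex.Im z| <= normc z.
Proof.
case: z => a b /=; rewrite -sqrtr_sqr ler_sqrt ?addr_ge0 ?sqr_ge0//.
by rewrite lerDr sqr_ge0.
Qed.

Lemma normc_le_ReDIm z : normc z <= `|complex.Re z| + `|complex.Im z|.
Proof.
case: z => a b /=; rewrite -[leRHS]ger0_norm ?addr_ge0// -sqrtr_sqr.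
rewrite ler_sqrt ?sqr_ge0// -[a ^+ 2]real_normK ?num_real//.
by rewrite -[b ^+ 2]real_normK ?num_real// sqrrD lerD2r lerDl mulrn_wge0// mulr_ge0.
Qed.

Lemma normc_real r : normc (r%:C) = `|r|.
Proof. by rewrite /= expr0n addr0 sqrtr_sqr. Qed.

Lemma normc_eq0 z : (normc z == 0) = (z == 0).
Proof.
by apply/eqP/eqP => [/Normc.eq0_normc//|->]; rewrite Normc.normc0.
Qed.

Lemma normc_gt0 z : (0 < normc z) = (z != 0).
Proof. by rewrite lt0r normc_ge0 andbT normc_eq0. Qed.

Lemma Re_add z w : complex.Re (z + w) = complex.Re z + complex.Re w.
Proof. by case: z; case: w. Qed.
Lemma Im_add z w : complex.Im (z + w) = complex.Im z + complex.Im w.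
Proof. by case: z; case: w. Qed.
Lemma Re_mul z w : complex.Re (z * w) =
  complex.Re z * complex.Re w - complex.Im z * complex.Im w.
Proof. by case: z; case: w. Qed.
Lemma Im_mul z w : complex.Im (z * w) =
  complex.Re z * complex.Im w + complex.Im z * complex.Re w.
Proof. by case: z; case: w. Qed.

Lemma cexpD z w : cexp (z + w) = cexp z * cexp w.
Proof.
case: z w => [a b] [c d]; rewrite /cexp /= expRD cosD sinD.
by apply/eqP; rewrite eq_complex /=; apply/andP; split; apply/eqP; ring.
Qed.

Lemma cexp0 : cexp 0 = 1 :> R[i].
Proof. by rewrite /cexp /= expR0 cos0 sin0 mul1r. Qed.

Lemma cexp_real r : cexp r%:C = (expR r)%:C.
Proof. by rewrite /cexp /= cos0 sin0 mulr1. Qed.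

Lemma normc_cexp z : normc (cexp z) = expR (complex.Re z).
Proof.
rewrite /cexp Normc.normcM normc_real ger0_norm ?expR_ge0//=.
by rewrite cos2Dsin2 sqrtr1 mulr1.
Qed.

Lemma normc_cpow t z : normc (cpow t z) = expR (complex.Re z * ln t).
Proof. by rewrite /cpow normc_cexp Re_mul /= mulr0 subr0. Qed.

Lemma cpowD t z w : cpow t (z + w) = cpow t z * cpow t w.
Proof. by rewrite /cpow mulrDl cexpD. Qed.

Lemma cpowM t s z : 0 < t -> 0 < s -> cpow (t * s) z = cpow t z * cpow s z.
Proof.
by move=> t0 s0; rewrite /cpow lnM ?posrE// rmorphD mulrDr cexpD.
Qed.

Lemma cpow_real t r : 0 < t -> cpow t r%:C = (t `^ r)%:C.
Proof.
by move=> t0; rewrite /cpow -rmorphM cexp_real /powR gt_eqF.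
Qed.

Lemma cpow0 t : cpow t 0 = 1.
Proof. by rewrite /cpow mul0r cexp0. Qed.

Lemma cpow1 t : 0 < t -> cpow t 1 = t%:C.
Proof. by move=> t0; rewrite cpow_real// powRr1// ltW. Qed.

Lemma cpowB1 t z : 0 < t -> cpow t z = t%:C * cpow t (z - 1).
Proof. by move=> t0; rewrite -[in t%:C * _](cpow1 t0) -cpowD subrKC. Qed.

End complex_algebra.

(** * Affine change of variable in the Lebesgue integral *)

Section affine_change_of_variable.
Context {R : realType}.
Notation mu := (@lebesgue_measure R).
Variables (a b : R).
Hypothesis a_gt0 : 0 < a.

Let phi : measurableTypeR R -> measurableTypeR R := fun x => a * x + b.

Let mphi : measurable_fun [set: measurableTypeR R] phi.
Proof. by apply: measurable_funD => //; apply: measurable_funM. Qed.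

(** Equal to Lebesgue measure, since it agrees with it on half-open intervals. *)
Let image_measure : {measure set (measurableTypeR R) -> \bar R} :=
  mscale (NngNum (ltW a_gt0)) 
    (measure_function_pushforward__canonical__measure_function_Measure mu mphi).

Let image_measureE (A : set (measurableTypeR R)) : measurable A ->
  mu A = image_measure A.
Proof.
move=> mA; apply: lebesgue_measure_unique => // _ [] [c d] _ <-.
change (mu `]c, d]%classic = a%:E * mu (phi @^-1` `]c, d]%classic))%E.
rewrite (_ : phi @^-1` _ = `](c - b) / a, (d - b) / a]%classic); last first.
  apply/seteqP; split => t /=; rewrite /phi !in_itv /= ltr_pdivrMr// ler_pdivlMr//;
    by move=> /andP[? ?]; apply/andP; split; lra.
rewrite !lebesgue_measure_itv /= !lte_fin ltr_pM2r ?invr_gt0// ltrD2r.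
case: ifPn => _; last by rewrite mule0.
by rewrite -!EFinB -EFinM; congr EFin; field; rewrite gt_eqF.
Qed.

Local Open Scope ereal_scope.

(** Stated for measurable f because the Euler kernels are discontinuous, and
unbounded when the real part of a parameter is less than one. *)
Lemma ge0_integral_affine (f : R -> \bar R) :
  measurable_fun setT f -> (forall x, 0 <= f x) ->
  \int[mu]_x f x = \int[mu]_x (a%:E * f (a * x + b)%R).
Proof.
move=> mf f0.
rewrite (@eq_measure_integral _ _ _ _ image_measure); last first.
  by move=> A mA _; exact: image_measureE.
rewrite /image_measure ge0_integral_mscale//.
rewrite (ge0_integral_pushforward mphi)// preimage_setT.
rewrite ge0_integralZl_EFin//; first exact: (measurableT_comp mf mphi).
exact: ltW.
Qed.

Lemma integral_affine (f : R -> \bar R) : measurable_fun setT f ->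
  \int[mu]_x f x = \int[mu]_x (a%:E * f (a * x + b)%R).
Proof.
move=> mf; rewrite integralE [RHS]integralE.
rewrite ge0_funeposM ?ge0_funenegM; [|exact: ltW|exact: ltW].
rewrite [X in X - _]ge0_integral_affine//; last exact: measurable_funepos.
rewrite [X in _ - X]ge0_integral_affine//; last exact: measurable_funeneg.
by congr (_ - _); apply: eq_integral => x _; rewrite ?funeposE ?funenegE.
Qed.

End affine_change_of_variable.

(** * Integration of complex functions *)

Section complex_integration.
Context {R : realType}.
Notation mu := (@lebesgue_measure R).
Notation normc := Normc.normc.
Implicit Types (f g : R -> R[i]) (D : set R).

Definition cmeasurable d (T : measurableType d) (f : T -> R[i]) :=
  measurable_fun setT (fun t => complex.Re (f t)) /\
  measurable_fun setT (fun t => complex.Im (f t)).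

Lemma cmeasurableM d (T : measurableType d) (f g : T -> R[i]) :
  cmeasurable f -> cmeasurable g -> cmeasurable (fun t => f t * g t).
Proof.
move=> [rf jf] [rg jg]; split.
  under eq_fun do rewrite Re_mul.
  by apply: measurable_funB; apply: measurable_funM.
under eq_fun do rewrite Im_mul.
by apply: measurable_funD; apply: measurable_funM.
Qed.

Lemma cmeasurable_cst d (T : measurableType d) (z : R[i]) :
  cmeasurable (fun _ : T => z).
Proof. by split; exact: measurable_cst. Qed.

Lemma cmeasurable_real d (T : measurableType d) (h : T -> R) :
  measurable_fun setT h -> cmeasurable (fun t => (h t)%:C).
Proof. by move=> mh; split=> //; exact: measurable_cst. Qed.

Lemma cmeasurable_comp d d' (T : measurableType d) (T' : measurableType d')
    (f : T -> R[i]) (h : T' -> T) :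
  cmeasurable f -> measurable_fun setT h -> cmeasurable (f \o h).
Proof.
move=> [rf jf] mh; split; [exact: (measurableT_comp rf)|].
  exact: (measurableT_comp jf).
Qed.

Lemma cmeasurable_if d (T : measurableType d) (b : T -> bool) (f g : T -> R[i]) :
  measurable_fun setT b -> cmeasurable f -> cmeasurable g ->
  cmeasurable (fun t => if b t then f t else g t).
Proof.
move=> mb [rf jf] [rg jg]; split.
  rewrite [X in measurable_fun _ X](_ : _ = fun t => if b t then complex.Re (f t)
    else complex.Re (g t)); last by apply/funext => t; case: (b t).
  exact: measurable_fun_ifT.
rewrite [X in measurable_fun _ X](_ : _ = fun t => if b t then complex.Im (f t)
  else complex.Im (g t)); last by apply/funext => t; case: (b t).
exact: measurable_fun_ifT.
Qed.

Lemma measurable_normc d (T : measurableType d) (f : T -> R[i]) :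
  cmeasurable f -> measurable_fun setT (fun t => normc (f t)).
Proof.
move=> [rf jf].
rewrite [X in measurable_fun _ X](_ : _ = (fun x : R => x `^ 2^-1) \o
  (fun t => complex.Re (f t) ^+ 2 + complex.Im (f t) ^+ 2)); last first.
  apply/funext => t /=; rewrite powR12_sqrt ?addr_ge0 ?sqr_ge0//.
  by case: (f t).
apply: measurableT_comp => //.
by apply: measurable_funD; apply: measurable_funX.
Qed.

Lemma cmeasurable_cpow (z : R[i]) : cmeasurable (fun t : R => cpow t z).
Proof.
have mcos : measurable_fun setT (@cos R).
  by apply: continuous_measurable_fun; exact: continuous_cos.
have msin : measurable_fun setT (@sin R).
  by apply: continuous_measurable_fun; exact: continuous_sin.
rewrite /cpow /cexp; apply: cmeasurableM.
  apply: cmeasurable_real; apply: measurableT_comp => //.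
  rewrite [X in measurable_fun _ X](_ : _ = fun t => complex.Re z * ln t).
    exact: measurable_funM.
  by apply/funext => t; rewrite Re_mul /= mulr0 subr0.
rewrite [X in cmeasurable X](_ : _ = fun t =>
    cos (complex.Im z * ln t) +i* sin (complex.Im z * ln t)); last first.
  by apply/funext => t; rewrite Im_mul /= mulr0 add0r.
have mz : measurable_fun setT (fun t : R => complex.Im z * ln t).
  exact: measurable_funM.
by split => /=; exact: measurableT_comp.
Qed.

Lemma cintegrable_normc D f : measurable D -> cmeasurable f ->
  (\int[mu]_(t in D) (normc (f t))%:E < +oo)%E -> cintegrable D f.
Proof.
move=> mD [rf jf] foo; split.
  apply/integrableP; split; first exact/measurable_EFinP/measurable_funTS.
  apply: le_lt_trans foo; apply: ge0_le_integral => //=.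
  - by apply/measurable_EFinP/measurable_funTS/measurableT_comp.
  - exact/measurable_EFinP/measurable_funTS/measurable_normc.
  - by move=> t _; rewrite lee_fin ler_norm_Re.
apply/integrableP; split; first exact/measurable_EFinP/measurable_funTS.
apply: le_lt_trans foo; apply: ge0_le_integral => //=.
- by apply/measurable_EFinP/measurable_funTS/measurableT_comp.
- exact/measurable_EFinP/measurable_funTS/measurable_normc.
- by move=> t _; rewrite lee_fin ler_norm_Im.
Qed.

Lemma eq_cintegral D f g : {in D, f =1 g} -> cintegral D f = cintegral D g.
Proof.
by move=> fg; congr (_ +i* _); apply: eq_Rintegral => t tD; rewrite fg.
Qed.

Lemma cintegral_mkcond D f :
  cintegral D f = cintegral setT (fun t => if t \in D then f t else 0).
Proof.
by congr (_ +i* _); rewrite Rintegral_mkcond; apply: eq_Rintegral => t _;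
  rewrite patchE; case: ifP.
Qed.

Lemma cintegralZl D f (c : R[i]) : measurable D -> cintegrable D f ->
  cintegral D (fun t => c * f t) = c * cintegral D f.
Proof.
move=> mD [rf jf]; rewrite /cintegral.
under eq_Rintegral do rewrite Re_mul.
under [X in _ +i* X]eq_Rintegral do rewrite Im_mul.
have Z k h : mu.-integrable D (fun t => (h t)%:E) ->
    mu.-integrable D (fun t => (k * h t)%:E).
  by move=> ih; under eq_fun do rewrite EFinM; exact: integrableZl.
rewrite RintegralB//; [|exact: Z|exact: Z].
rewrite RintegralD//; [|exact: Z|exact: Z].
by rewrite !RintegralZl//; case: c => a b /=.
Qed.

Lemma cintegralZr D f (c : R[i]) : measurable D -> cintegrable D f ->
  cintegral D (fun t => f t * c) = cintegral D f * c.
Proof.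
by move=> mD ? ; rewrite mulrC -cintegralZl//; apply: eq_cintegral => t _; rewrite mulrC.
Qed.

Lemma cintegralD D f g : measurable D -> cintegrable D f -> cintegrable D g ->
  cintegral D (fun t => f t + g t) = cintegral D f + cintegral D g.
Proof.
move=> mD [rf jf] [rg jg]; rewrite /cintegral.
under eq_Rintegral do rewrite Re_add.
under [X in _ +i* X]eq_Rintegral do rewrite Im_add.
by rewrite !RintegralD.
Qed.

(** Rotating the integral onto the positive half-line turns its modulus into the
integral of a real part. *)
Lemma normc_cintegral_le D f : measurable D -> cmeasurable f ->
  (\int[mu]_(t in D) (normc (f t))%:E < +oo)%E ->
  ((normc (cintegral D f))%:E <= \int[mu]_(t in D) (normc (f t))%:E)%E.
Proof.
move=> mD mf foo; have cf := cintegrable_normc mD mf foo.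
have mnf : measurable_fun D (fun t => (normc (f t))%:E).
  exact/measurable_EFinP/measurable_funTS/measurable_normc.
have [->|I0] := eqVneq (cintegral D f) 0.
  by rewrite Normc.normc0 integral_ge0// => t _; rewrite lee_fin normc_ge0.
set I := cintegral D f in I0 *.
pose c : R[i] := (normc I)%:C / I.
have nI : normc I != 0 by rewrite normc_eq0.
have nc : normc c = 1.
  by rewrite Normc.normcM Normc.normcV normc_real ger0_norm ?normc_ge0// divff.
have cI : c * I = (normc I)%:C by rewrite /c divfK.
have -> : normc I = complex.Re (cintegral D (fun t => c * f t)).
  by rewrite cintegralZl// cI.
have foo' : (\int[mu]_(t in D) (normc (c * f t))%:E < +oo)%E.
  by under eq_integral do rewrite Normc.normcM nc mul1r.
have [icf _] := cintegrable_normc mD (cmeasurableM (cmeasurable_cst _ c) mf) foo'.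
rewrite /= /Rintegral fineK; last exact: integrable_fin_num.
apply: le_integral => //.
  apply/integrableP; split => //.
  by under eq_integral do rewrite /= ger0_norm ?normc_ge0//.
move=> t _; rewrite lee_fin (le_trans (ler_norm _))// (le_trans (ler_norm_Re _))//.
by rewrite Normc.normcM nc mul1r.
Qed.

Lemma cintegral_affine (a b : R) f : 0 < a -> cmeasurable f ->
  cintegral setT f = cintegral setT (fun t => a%:C * f (a * t + b)).
Proof.
move=> a0 [rf jf]; rewrite /cintegral /Rintegral; congr (fine _ +i* fine _).
  rewrite (integral_affine b a0); last exact/measurable_EFinP.
  by apply: eq_integral => t _; rewrite Re_mul /= mul0r subr0.
rewrite (integral_affine b a0); last exact/measurable_EFinP.
by apply: eq_integral => t _; rewrite Im_mul /= mul0r addr0.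
Qed.

(** Fubini for complex kernels. Requiring every section to be integrable, and
not only almost every one, makes the real-valued iterated integrals agree with
the extended-real ones. *)
Lemma cintegral_swap (K : R * R -> R[i]) : cmeasurable K ->
  (\int[mu]_s \int[mu]_u (normc (K (s, u)))%:E < +oo)%E ->
  (forall s, \int[mu]_u (normc (K (s, u)))%:E < +oo)%E ->
  (forall u, \int[mu]_s (normc (K (s, u)))%:E < +oo)%E ->
  cintegral setT (fun s => cintegral setT (fun u => K (s, u))) =
  cintegral setT (fun u => cintegral setT (fun s => K (s, u))).
Proof.
move=> mK Koo Ks Ku.
have swap (h : R * R -> R) : measurable_fun setT h ->
    (forall x, `|h x| <= normc (K x)) ->
    \int[mu]_s \int[mu]_u h (s, u) = \int[mu]_u \int[mu]_s h (s, u).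
  move=> mh hK.
  have mhE : measurable_fun setT (EFin \o h) by exact/measurable_EFinP.
  have bnd (v : R -> R * R) : measurable_fun setT v ->
      (\int[mu]_t (normc (K (v t)))%:E < +oo)%E ->
      (\int[mu]_t (h (v t))%:E)%E \is a fin_num.
    move=> mv voo; apply: integrable_fin_num => //; apply/integrableP; split.
      exact: (measurableT_comp mhE mv).
    apply: le_lt_trans voo; apply: ge0_le_integral => //=.
    - apply/measurable_EFinP; apply: measurableT_comp => //.
      exact: (measurableT_comp mh mv).
    - apply/measurable_EFinP.
      exact: (measurableT_comp (measurable_normc mK) mv).
    - by move=> t _; rewrite lee_fin.
  rewrite /Rintegral; congr fine.
  under eq_integral do rewrite fineK ?(bnd (pair _))//.
  under [RHS]eq_integral do rewrite fineK ?(bnd (fun s => (s, _)))//.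
  apply: (@Fubini _ _ _ _ _ mu mu (EFin \o h)).
  apply/integrable12ltyP; first exact: mhE.
  apply: le_lt_trans Koo; apply: ge0_le_integral => //.
  - by move=> s _; exact: integral_ge0.
  - apply: (@measurable_fun_fubini_tonelli_F _ _ _ _ _ mu
      (abse \o (EFin \o h))) => //=.
    exact: measurableT_comp.
  - apply: (@measurable_fun_fubini_tonelli_F _ _ _ _ _ mu
      (fun x => (normc (K x))%:E)).
      exact/measurable_EFinP/measurable_normc.
    by move=> x; rewrite lee_fin normc_ge0.
  - move=> s _; apply: ge0_le_integral => //=.
    + apply/measurable_EFinP; apply: measurableT_comp => //.
      exact: (measurableT_comp mh (pair1_measurable s)).
    + apply/measurable_EFinP.
      exact: (measurableT_comp (measurable_normc mK) (pair1_measurable s)).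
    + by move=> u _; rewrite lee_fin.
have hR := swap (fun x => complex.Re (K x)) mK.1 (fun x => ler_norm_Re (K x)).
have hI := swap (fun x => complex.Im (K x)) mK.2 (fun x => ler_norm_Im (K x)).
by rewrite /cintegral /= hR hI.
Qed.

End complex_integration.

(** * The Euler kernels and their masses *)

Section euler_kernels.
Context {R : realType}.
Notation mu := (@lebesgue_measure R).
Notation normc := Normc.normc.
Implicit Types (p q : R[i]) (s t u : R).

(** The kernels are extended by zero to the whole line, where the measure is
invariant under translations. *)
Definition gamma_kernel p s : R[i] :=
  if 0 < s then cpow s (p - 1) * (expR (- s))%:C else 0.

Definition beta_kernel p q t : R[i] :=
  if 0 < t < 1 then cpow t (p - 1) * cpow (1 - t) (q - 1) else 0.

(** Gamma (Re p) and B(Re p, Re q) as extended reals, so that the product formula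
can be proved before finiteness is known. *)
Definition gamma_mass p : \bar R := \int[mu]_s (normc (gamma_kernel p s))%:E.

Definition beta_mass p q : \bar R := \int[mu]_t (normc (beta_kernel p q t))%:E.

Definition cbeta p q : R[i] := cintegral setT (beta_kernel p q).

Lemma Gamma_integralE p : Gamma_integral p = cintegral setT (gamma_kernel p).
Proof.
rewrite /Gamma_integral cintegral_mkcond; apply: eq_cintegral => s _.
by rewrite mem_setE in_itv /= andbT.
Qed.

Lemma cmeasurable_gamma_kernel p : cmeasurable (gamma_kernel p).
Proof.
apply: cmeasurable_if; [exact: measurable_fun_ltr| |exact: cmeasurable_cst].
apply: cmeasurableM; first exact: cmeasurable_cpow.
by apply: cmeasurable_real; exact: measurableT_comp.
Qed.

Lemma cmeasurable_beta_kernel p q : cmeasurable (beta_kernel p q).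
Proof.
apply: cmeasurable_if; last exact: cmeasurable_cst.
  by apply: measurable_and; exact: measurable_fun_ltr.
apply: cmeasurableM; first exact: cmeasurable_cpow.
apply: (cmeasurable_comp (cmeasurable_cpow (q - 1))).
exact: measurable_funB.
Qed.

Lemma normc_gamma_kernel p s : normc (gamma_kernel p s) =
  if 0 < s then expR ((complex.Re p - 1) * ln s - s) else 0.
Proof.
rewrite /gamma_kernel; case: ifP => s0; last by rewrite Normc.normc0.
rewrite Normc.normcM normc_cpow normc_real ger0_norm ?expR_ge0//.
by rewrite -expRD; case: p.
Qed.

Lemma eq_normc_gamma_kernel p q s : complex.Re p = complex.Re q ->
  normc (gamma_kernel p s) = normc (gamma_kernel q s).
Proof. by move=> pq; rewrite !normc_gamma_kernel pq. Qed.

Lemma eq_gamma_mass p q : complex.Re p = complex.Re q ->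
  gamma_mass p = gamma_mass q.
Proof.
by move=> pq; apply: eq_integral => s _; rewrite (eq_normc_gamma_kernel _ pq).
Qed.

Lemma gamma_mass_ge0 p : (0 <= gamma_mass p)%E.
Proof. by apply: integral_ge0 => s _; rewrite lee_fin normc_ge0. Qed.

Lemma beta_mass_ge0 p q : (0 <= beta_mass p q)%E.
Proof. by apply: integral_ge0 => s _; rewrite lee_fin normc_ge0. Qed.

Lemma gamma_kernel_le0 p s : s <= 0 -> gamma_kernel p s = 0.
Proof. by move=> s0; rewrite /gamma_kernel ltNge s0. Qed.

(** The substitution (s, r) = (u t, u (1 - t)) behind Euler's formula
Gamma p * Gamma q = Gamma (p + q) * B(p, q), read on the integrands. *)
Lemma gamma_kernel_split p q u t : 0 < u ->
  u%:C * (gamma_kernel p (u * t) * gamma_kernel q (u - u * t)) =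
  gamma_kernel (p + q) u * beta_kernel p q t.
Proof.
move=> u0; have -> : u - u * t = u * (1 - t) by ring.
rewrite /gamma_kernel /beta_kernel !pmulr_rgt0// subr_gt0 u0.
case: ifP => t0; last by rewrite mul0r mulr0 mulr0.
case: ifP => t1; last by rewrite !mulr0.
have t10 : 0 < 1 - t by rewrite subr_gt0.
rewrite /= !cpowM//.
have -> : cpow u (p + q - 1) = u%:C * cpow u (p - 1) * cpow u (q - 1).
  by rewrite -(cpow1 u0) -!cpowD; congr cpow; ring.
have -> : (expR (- u))%:C = (expR (- (u * t)))%:C * (expR (- (u * (1 - t))))%:C :> R[i].
  by rewrite -rmorphM -expRD; congr (expR _)%:C; ring.
by ring.
Qed.

(** Integrating over x.2 first separates the two factors, integrating over x.1 first
produces the convolution; this is the kernel exchanged in Euler's formula. *)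
Definition euler_conv p q (x : R * R) : R[i] :=
  gamma_kernel p x.1 * gamma_kernel q (x.2 - x.1).

Lemma cmeasurable_euler_conv p q : cmeasurable (euler_conv p q).
Proof.
apply: cmeasurableM.
  exact: (cmeasurable_comp (cmeasurable_gamma_kernel p) measurable_fst).
apply: (cmeasurable_comp (cmeasurable_gamma_kernel q)).
exact: measurable_funB.
Qed.

Let measurable_norm_gamma p : measurable_fun setT (fun s => (normc (gamma_kernel p s))%:E).
Proof. exact/measurable_EFinP/measurable_normc/cmeasurable_gamma_kernel. Qed.

Let measurable_norm_beta p q : measurable_fun setT (fun s => (normc (beta_kernel p q s))%:E).
Proof. exact/measurable_EFinP/measurable_normc/cmeasurable_beta_kernel. Qed.

Let cmeasurable_sub q s : cmeasurable (fun u => gamma_kernel q (u - s)).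
Proof.
apply: (cmeasurable_comp (cmeasurable_gamma_kernel q)).
exact: measurable_funB.
Qed.

Lemma euler_conv_mass1 p q s : (\int[mu]_u (normc (euler_conv p q (s, u)))%:E =
  (normc (gamma_kernel p s))%:E * gamma_mass q)%E.
Proof.
under eq_integral do rewrite Normc.normcM EFinM.
rewrite /= ge0_integralZl_EFin; last 4 first.
- exact: measurableT.
- by move=> u _; rewrite lee_fin normc_ge0.
- exact/measurable_EFinP/measurable_normc/cmeasurable_sub.
- exact: normc_ge0.
rewrite /gamma_mass (@ge0_integral_affine _ 1 (- s) ltr01
  (fun u => (normc (gamma_kernel q u))%:E)).
- by congr (_ * _)%E; apply: eq_integral => u _; rewrite mul1e mul1r.
- exact: measurable_norm_gamma.
- by move=> u; rewrite lee_fin normc_ge0.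
Qed.

Lemma euler_conv_mass2 p q u : (\int[mu]_s (normc (euler_conv p q (s, u)))%:E =
  (normc (gamma_kernel (p + q) u))%:E * beta_mass p q)%E.
Proof.
have [u0|u0] := ltP 0 u; last first.
  rewrite gamma_kernel_le0// Normc.normc0 mul0e integral0_eq// => s _.
  have [s0|s0] := ltP 0 s.
    by rewrite /euler_conv /= (@gamma_kernel_le0 q) ?mulr0 ?Normc.normc0//; lra.
  by rewrite /euler_conv /= (@gamma_kernel_le0 p) ?mul0r ?Normc.normc0//.
rewrite -ge0_integralZl_EFin ?normc_ge0//=; last 2 first.
- by move=> t _; rewrite lee_fin normc_ge0.
- exact: measurable_norm_beta.
rewrite (@ge0_integral_affine _ u 0)//.
- apply: eq_integral => t _; rewrite addr0 -!EFinM -Normc.normcM.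
  rewrite -(gamma_kernel_split p q t u0) [in RHS]Normc.normcM normc_real.
  by rewrite ger0_norm// ltW.
- apply/measurable_EFinP/measurable_normc.
  exact: (cmeasurable_comp (@cmeasurable_euler_conv p q) (pair2_measurable u)).
- by move=> s; rewrite lee_fin normc_ge0.
Qed.

(** Tonelli's theorem, so that the identity also holds between infinite values; it
is what makes the Beta integral finite. *)
Lemma gamma_massM p q :
  (gamma_mass p * gamma_mass q = gamma_mass (p + q)%R * beta_mass p q)%E.
Proof.
have massZ r (c : \bar R) : (0 <= c)%E ->
    (gamma_mass r * c = \int[mu]_s ((normc (gamma_kernel r s))%:E * c))%E.
  move=> c0; rewrite ge0_integralZr//; first exact: measurable_norm_gamma.
  by move=> s _; rewrite lee_fin normc_ge0.
rewrite (massZ p _ (gamma_mass_ge0 q)) (massZ _ _ (beta_mass_ge0 p q)).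
under eq_integral do rewrite -euler_conv_mass1.
under [RHS]eq_integral do rewrite -euler_conv_mass2.
apply: (@fubini_tonelli _ _ _ _ _ mu mu (fun x => (normc (euler_conv p q x))%:E)).
  exact/measurable_EFinP/measurable_normc/cmeasurable_euler_conv.
by move=> x; rewrite lee_fin normc_ge0.
Qed.

End euler_kernels.

(** * The primitive of a complex power *)

Section cpow_primitive.
Context {R : realType}.
Notation mu := (@lebesgue_measure R).
Notation normc := Normc.normc.
Implicit Types (p q : R[i]) (s t u : R).

(** The constant c gives access to every real component of the power: c = 1 is the
real part and c = -i the imaginary part. *)
Lemma is_derive_Re_cpow (c p : R[i]) t : 0 < t ->
  is_derive t 1 (fun t : R => complex.Re (c * cpow t p))
    (complex.Re (c * (p * cpow t (p - 1)))).
Proof.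
move=> t0; have dln := is_derive1_ln t0.
pose a : R := complex.Re p; pose b : R := complex.Im p.
have lin (k : R) : is_derive t 1 (fun t : R => k * ln t) (k * t^-1).
  exact: (is_deriveZ k dln).
have de := @is_derive1_comp _ expR (fun t : R => a * ln t) _ _ _ (is_derive_expR _) (lin a).
have dc := @is_derive1_comp _ cos (fun t : R => b * ln t) _ _ _ (is_derive_cos _) (lin b).
have ds := @is_derive1_comp _ sin (fun t : R => b * ln t) _ _ _ (is_derive_sin _) (lin b).
have D := is_deriveM de (is_deriveB (is_deriveZ (complex.Re c) dc)
  (is_deriveZ (complex.Im c) ds)).
have cpowE s : cpow s p = (expR (a * ln s))%:C * (cos (b * ln s) +i* sin (b * ln s)).
  by rewrite /cpow /cexp Re_mul Im_mul /= !mulr0 subr0 add0r.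
rewrite (_ : (fun _ => _) = ((expR \o (fun t => a * ln t)) *
  (complex.Re c \*: (cos \o (fun t : R => b * ln t)) -
   complex.Im c \*: (sin \o (fun t : R => b * ln t)))))%R; last first.
  apply/funext => s; rewrite cpowE Re_mul Re_mul Im_mul /=.
  rewrite !(mul0r, subr0, addr0, add0r).
  by rewrite !fctE /= /GRing.scale /=; ring.
apply: is_derive_eq; rewrite !fctE /= /GRing.scale /=.
have -> : cpow t (p - 1) = (t^-1)%:C * cpow t p.
  by rewrite (cpowB1 p t0) mulrA -rmorphM mulVf ?gt_eqF// mul1r.
rewrite cpowE !Re_mul !Im_mul /= !(mul0r, subr0, addr0, add0r) -/a -/b.
by ring.
Qed.


Lemma integral_Re_cpow (c p : R[i]) (a : R) : 0 < a < 1 ->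
  (\int[mu]_(t in `[a, 1%R]) (complex.Re (c * (p * cpow t (p - 1))))%:E =
  (complex.Re (c * (1 - cpow a p)))%:E)%E.
Proof.
move=> /andP[a0 a1]; pose F t := complex.Re (c * cpow t p).
have dF t : 0 < t -> is_derive t 1 F (complex.Re (c * (p * cpow t (p - 1)))).
  exact: is_derive_Re_cpow.
have cF t : 0 < t -> F s @[s --> t] --> F t.
  move=> t0; apply: differentiable_continuous; apply/derivable1_diffP.
  exact: (@ex_derive _ _ _ _ _ _ _ (dF t t0)).
have df t : 0 < t ->
    derivable (fun t : R => complex.Re (c * (p * cpow t (p - 1)))) t 1.
  move=> t0; rewrite (_ : (fun _ => _) =
    fun t : R => complex.Re (c * p * cpow t (p - 1))).
    exact: (@ex_derive _ _ _ _ _ _ _ (is_derive_Re_cpow _ _ t0)).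
  by apply/funext => s; rewrite mulrA.
rewrite (@continuous_FTC2 _ _ F)//.
- rewrite /F -EFinB; congr EFin.
  rewrite [cpow 1 p]/cpow ln1 mulr0 cexp0 mulrBr !mulr1.
  by rewrite Re_add; case: (c * cpow a p).
- apply: derivable_within_continuous => t.
  by rewrite in_itv /= => /andP[at_ _]; exact/df/(lt_le_trans a0 at_).
- split.
  + move=> t; rewrite in_itv /= => /andP[at_ _].
    exact: (@ex_derive _ _ _ _ _ _ _ (dF t (lt_trans a0 at_))).
  + exact/cvg_at_right_filter/cF.
  + exact/cvg_at_left_filter/cF.
- move=> t; rewrite in_itv /= => /andP[at_ _]; rewrite derive1E.
  exact: (@derive_val _ _ _ _ _ _ _ (dF t (lt_trans a0 at_))).
Qed.

Lemma normc_beta_kernel1 p t : normc (beta_kernel p 1 t) =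
  if 0 < t < 1 then expR ((complex.Re p - 1) * ln t) else 0.
Proof.
rewrite /beta_kernel subrr cpow0 mulr1; case: ifP => _.
  by rewrite normc_cpow; case: p.
by rewrite Normc.normc0.
Qed.

(** Monotone limit of the integrals over [1/n, 1], all at most 1 / Re p. *)
Lemma beta_mass1_lty p : 0 < complex.Re p -> (beta_mass p 1%R < +oo)%E.
Proof.
set r := complex.Re p => r0.
pose f t := (normc (beta_kernel p 1 t))%:E.
have f0 t : (0 <= f t)%E by rewrite lee_fin normc_ge0.
have mf : measurable_fun setT f.
  exact/measurable_EFinP/measurable_normc/cmeasurable_beta_kernel.
pose D n : set R := `[n.+2%:R^-1, 1]%classic.
have a01 n : 0 < (n.+2%:R^-1 : R) < 1.
  by rewrite invr_gt0 ltr0n /= invf_lt1 ?ltr0n// ltr1n.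
pose g n := f \_ (D n).
have mg n : measurable_fun setT (g n).
  apply: (measurable_restrictT _ (measurable_itv _)).1; exact: measurable_funTS.
have g0 n t : (0 <= g n t)%E by apply: erestrict_ge0 => s _; exact: f0.
have ndg t : {homo g ^~ t : n m / (n <= m)%N >-> (n <= m)%E}.
  move=> n m nm; rewrite /g !patchE; case: ifPn => [tn|_]; last first.
    by case: ifP.
  rewrite ifT//; move: tn; rewrite !inE /D /= !in_itv /= => /andP[nt ->].
  by rewrite andbT (le_trans _ nt)// lef_pV2 ?posrE ?ltr0n// ler_nat !ltnS.
have limg t : limn (g ^~ t) = f t.
  have [t0|t0] := ltP 0 t; last first.
    have ft : f t = 0%E by rewrite /f normc_beta_kernel1 ltNge t0.
    rewrite (_ : g ^~ t = cst 0%E) ?ft ?lim_cst//.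
    by apply/funext => n; rewrite /g patchE ft; case: ifP.
  have [t1|t1] := leP t 1; last first.
    have ft : f t = 0%E by rewrite /f normc_beta_kernel1 t0 ltNge (ltW t1).
    rewrite (_ : g ^~ t = cst 0%E) ?ft ?lim_cst//.
    by apply/funext => n; rewrite /g patchE ft; case: ifP.
  apply/cvg_lim => //; apply: cvg_near_cst.
  near=> n; rewrite /g patchE ifT// inE /D /= in_itv /= t1 andbT.
  rewrite invf_ple ?posrE//; near: n.
  exists (Num.truncn t^-1) => // n /= tn.
  apply: ltW; apply: lt_le_trans (truncnS_gt _) _.
  by rewrite ler_nat ltnS (leq_trans tn).
have bound n : (\int[mu]_t g n t <= (r^-1)%:E)%E.
  rewrite -integral_mkcond.
  apply: (@le_trans _ _ (\int[mu]_(t in D n)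
    (complex.Re ((r^-1)%:C * (r%:C * cpow t (r%:C - 1))))%:E)%E).
    apply: ge0_le_integral => //.
    - exact: measurable_itv.
    - exact: measurable_funTS.
    - apply/measurable_EFinP/measurable_funTS.
      apply: (cmeasurableM (cmeasurable_cst _ _)
        (cmeasurableM (cmeasurable_cst _ _) (cmeasurable_cpow _))).1.
    - move=> t Dt; have /andP[nt t1] : n.+2%:R^-1 <= t <= 1.
        by move: Dt; rewrite /D /= in_itv.
      have t0 : 0 < t by apply: lt_le_trans nt; have /andP[] := a01 n.
      rewrite lee_fin mulrA -rmorphM mulVf ?gt_eqF// mul1r.
      rewrite -(rmorphB _ r 1) cpow_real//=.
      rewrite normc_beta_kernel1 -/r /powR gt_eqF// t0.
      by case: ifP => // _; exact: expR_ge0.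
  rewrite integral_Re_cpow// lee_fin cpow_real; last by have /andP[] := a01 n.
  rewrite -(rmorphB _ 1 _) -rmorphM /=.
  by rewrite ler_piMr ?invr_ge0 ?ltW// gerBl powR_ge0.
rewrite /beta_mass -/(f _).
under eq_integral do rewrite -/(f _) -limg.
rewrite monotone_convergence//.
apply: (@le_lt_trans _ _ (r^-1)%:E); last exact: ltry.
apply: lime_le; last by apply: nearW => n; exact: bound.
apply: ereal_nondecreasing_is_cvgn => n m nm.
apply: ge0_le_integral => //; try exact: mg.
by move=> t _; exact: ndg.
Unshelve. all: by end_near. Qed.

End cpow_primitive.

(** * Euler's formula for the Beta integral *)

Section beta_formula.
Context {R : realType}.
Notation mu := (@lebesgue_measure R).
Notation normc := Normc.normc.
Implicit Types (p q : R[i]) (s t u : R).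

(** Tail of the Gamma integrand: for k = |r| + 1, the logarithm grows slowly enough
that ln s <= ln (2 k) + s / (2 k), so that r ln s uses up at most s / 2. *)
Lemma expR_ln_le_half (r s : R) : 0 < s ->
  expR (r * ln s - s) <= expR (`|r| * ln (2 * (`|r| + 1))) * expR (- (2^-1) * s)
  \/ s < 1.
Proof.
move=> s0; have [s1|] := leP 1 s; [left|by right].
rewrite -expRD ler_expR; set k := `|r| + 1.
have k0 : 0 < k by rewrite /k ltr_wpDl.
have lnk : ln s <= ln (2 * k) + s / (2 * k).
  rewrite -[s in ln s](@divfK _ (2 * k)) ?mulf_neq0 ?gt_eqF//.
  rewrite lnM ?posrE ?divr_gt0 ?mulr_gt0// addrC lerD2l.
  by apply: ltW; apply: ln_sublinear; rewrite divr_gt0// mulr_gt0.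
have h : r * ln s <= `|r| * (ln (2 * k) + s / (2 * k)).
  apply: (@le_trans _ _ (`|r| * ln s)).
    by apply: ler_wpM2r; [exact: ln_ge0|exact: ler_norm].
  exact: ler_wpM2l.
have h2 : `|r| * (s / (2 * k)) <= s / 2.
  have -> : `|r| * (s / (2 * k)) = (`|r| / k) * (s / 2) by field; rewrite gt_eqF.
  apply: ler_piMl; first by rewrite divr_ge0// ltW.
  by rewrite ler_pdivrMr// mul1r /k lerDl.
lra.
Qed.

(** Near 0 the integrand is at most the Beta kernel with second parameter 1, and away
from 0 at most a multiple of the exponential density of rate 1/2. *)
Lemma gamma_mass_lty p : 0 < complex.Re p -> (gamma_mass p < +oo)%E.
Proof.
move=> p0; set r := complex.Re p - 1.
pose C := 2 * expR (`|r| * ln (2 * (`|r| + 1))).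
have C0 : 0 <= C by rewrite mulr_ge0// expR_ge0.
have mb : measurable_fun setT (fun t => (normc (beta_kernel p 1 t))%:E).
  exact/measurable_EFinP/measurable_normc/cmeasurable_beta_kernel.
have me : measurable_fun setT (fun t => (exponential_pdf (2^-1 : R) t)%:E).
  by apply/measurable_EFinP; exact: measurable_exponential_pdf.
have e0 t : 0 <= exponential_pdf (2^-1 : R) t by exact: exponential_pdf_ge0.
apply: (@le_lt_trans _ _ (beta_mass p 1%R + C%:E *
    \int[mu]_t (exponential_pdf (2^-1)%R t)%:E)%E); last first.
  rewrite integral_exponential_pdf ?invr_gt0// mule1.
  by rewrite lte_add_pinfty ?ltry// beta_mass1_lty.
rewrite -ge0_integralZl_EFin//; last by move=> t _; rewrite lee_fin.
rewrite -ge0_integralD//; last 3 first.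
- by move=> t _; rewrite lee_fin normc_ge0.
- by move=> t _; rewrite mule_ge0 ?lee_fin.
- exact: measurable_funeM.
apply: ge0_le_integral => //.
- by move=> t _; rewrite lee_fin normc_ge0.
- exact/measurable_EFinP/measurable_normc/cmeasurable_gamma_kernel.
- by apply: emeasurable_funD => //; exact: measurable_funeM.
move=> s _; rewrite -EFinM -EFinD lee_fin normc_gamma_kernel -/r.
case: ifPn => [s0|_]; last by rewrite addr_ge0 ?normc_ge0// mulr_ge0.
have [s1|s1] := expR_ln_le_half r s0.
  apply: (le_trans s1); apply: ler_wpDl; first exact: normc_ge0.
  rewrite /exponential_pdf patchE ifT ?inE/= ?in_itv/= ?(ltW s0)//.
  by rewrite /C mulrACA mulfV// mul1r.
apply: ler_wpDr; first by rewrite mulr_ge0.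
by rewrite normc_beta_kernel1 s0 s1/= ler_expR -/r gerBl ltW.
Qed.

Lemma gamma_mass_gt0 p : (0 < gamma_mass p)%E.
Proof.
set r := complex.Re p - 1; pose m := expR (- `|r| - 2).
have mg : measurable_fun setT (fun t => (normc (gamma_kernel p t))%:E).
  exact/measurable_EFinP/measurable_normc/cmeasurable_gamma_kernel.
apply: (@lt_le_trans _ _ (\int[mu]_(t in `[1%R, 2%R]) (cst m%:E) t)%E).
  rewrite integral_cst//= lebesgue_measure_itv /= lte_fin ltr1n -EFinB.
  by rewrite -EFinM lte_fin mulr_gt0 ?expR_gt0// subr_gt0 ltr1n.
apply: (@le_trans _ _ (\int[mu]_(t in `[1%R, 2%R]) (normc (gamma_kernel p t))%:E)%E).
  apply: ge0_le_integral => //.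
  - by move=> t _; rewrite lee_fin expR_ge0.
  - exact: measurable_funTS.
  - move=> t /=; rewrite in_itv /= => /andP[t1 t2].
    have t0 : 0 < t by exact: lt_le_trans t1.
    rewrite lee_fin normc_gamma_kernel t0 ler_expR -/r.
    have l0 : 0 <= ln t by exact: ln_ge0.
    have l1 : ln t <= 1.
      by have := @le_ln1Dx R (t - 1); rewrite subrKC; lra.
    have : - `|r| <= r * ln t.
      rewrite lerNl -mulNr (le_trans (ler_norm _))// normrM normrN ler_piMr//.
      by rewrite ger0_norm.
    lra.
by apply: ge0_subset_integral => // t _; rewrite lee_fin normc_ge0.
Qed.

(** An infinite Beta mass would make the finite product Gamma p Gamma q infinite. *)
Lemma beta_mass_lty p q : 0 < complex.Re p -> 0 < complex.Re q ->
  (beta_mass p q < +oo)%E.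
Proof.
move=> p0 q0; have := gamma_massM p q.
rewrite ltNge leye_eq; apply: contraPN => /eqP ->.
rewrite gt0_muley ?gamma_mass_gt0// => /eqP.
rewrite lt_eqF// lte_mul_pinfty ?gamma_mass_ge0 ?gamma_mass_lty//.
by rewrite ge0_fin_numE ?gamma_mass_ge0 ?gamma_mass_lty.
Qed.

Lemma cintegrable_gamma_kernel p : 0 < complex.Re p ->
  cintegrable setT (gamma_kernel p).
Proof.
move=> p0; apply: cintegrable_normc => //; first exact: cmeasurable_gamma_kernel.
exact: gamma_mass_lty.
Qed.

Lemma cintegrable_beta_kernel p q : 0 < complex.Re p -> 0 < complex.Re q ->
  cintegrable setT (beta_kernel p q).
Proof.
move=> p0 q0; apply: cintegrable_normc => //.
  exact: cmeasurable_beta_kernel.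
exact: beta_mass_lty.
Qed.

(** Fubini's theorem for the convolution kernel; the three integrability conditions
are the mass identities. *)
Lemma Gamma_integralM p q : 0 < complex.Re p -> 0 < complex.Re q ->
  Gamma_integral p * Gamma_integral q = Gamma_integral (p + q) * cbeta p q.
Proof.
move=> p0 q0; rewrite !Gamma_integralE.
have pq0 : 0 < complex.Re (p + q) by rewrite Re_add addr_gt0.
have fin (a : R) (b : \bar R) : (0 <= b)%E -> (b < +oo)%E -> (a%:E * b < +oo)%E.
  by move=> b0 boo; rewrite -(@fineK _ b) ?ge0_fin_numE// -EFinM ltry.
rewrite -cintegralZr; [|exact: measurableT|exact: cintegrable_gamma_kernel].
rewrite -cintegralZr; [|exact: measurableT|exact: cintegrable_gamma_kernel].
transitivity (cintegral setT (fun s => cintegral setT (fun u => euler_conv p q (s, u)))).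
  apply: eq_cintegral => s _; rewrite /euler_conv /=.
  rewrite (cintegral_affine (- s) ltr01); last exact: cmeasurable_gamma_kernel.
  under [in LHS]eq_cintegral do rewrite mul1r mul1r.
  rewrite cintegralZl//; apply: cintegrable_normc => //.
    apply: (cmeasurable_comp (cmeasurable_gamma_kernel q)).
    exact: measurable_funB.
  have := gamma_mass_lty q0; rewrite /gamma_mass (@ge0_integral_affine _ 1 (- s))//.
  - by under eq_integral do rewrite mul1e mul1r.
  - exact/measurable_EFinP/measurable_normc/cmeasurable_gamma_kernel.
  - by move=> u; rewrite lee_fin normc_ge0.
rewrite cintegral_swap.
- apply: eq_cintegral => u _.
  have [u0|u0] := ltP 0 u; last first.
    rewrite gamma_kernel_le0// mul0r /cintegral /Rintegral.
    rewrite !integral0_eq//= => s _; (have [s0|s0] := ltP 0 s;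
      [rewrite /euler_conv /= (@gamma_kernel_le0 _ q) ?mulr0//; lra|
       by rewrite /euler_conv /= (@gamma_kernel_le0 _ p) ?mul0r]).
  rewrite -cintegralZl//; last exact: cintegrable_beta_kernel.
  rewrite (cintegral_affine 0 u0); last first.
    exact: (cmeasurable_comp (cmeasurable_euler_conv p q) (pair2_measurable u)).
  by apply: eq_cintegral => t _; rewrite addr0 /euler_conv /= gamma_kernel_split.
- exact: cmeasurable_euler_conv.
- under eq_integral do rewrite euler_conv_mass1.
  rewrite ge0_integralZr//; last 3 first.
  + exact/measurable_EFinP/measurable_normc/cmeasurable_gamma_kernel.
  + by move=> s _; rewrite lee_fin normc_ge0.
  + exact: gamma_mass_ge0.
  rewrite -(@fineK _ (\int[mu]_s _)%E).
    exact: fin (gamma_mass_ge0 _) (gamma_mass_lty _).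
  by rewrite ge0_fin_numE ?gamma_mass_lty ?gamma_mass_ge0.
- by move=> s; rewrite euler_conv_mass1 fin ?gamma_mass_ge0 ?gamma_mass_lty.
- by move=> u; rewrite euler_conv_mass2 fin ?beta_mass_ge0 ?beta_mass_lty.
Qed.

End beta_formula.

(** * Functional equation and elementary inequalities *)

Section gamma_functional_equation.
Context {R : realType}.
Notation mu := (@lebesgue_measure R).
Notation normc := Normc.normc.
Implicit Types (p q z : R[i]) (s t u : R).

Lemma cintegral_cpow p (a : R) : 0 < a < 1 ->
  cintegral `[a, 1] (fun t => p * cpow t (p - 1)) = 1 - cpow a p.
Proof.
move=> a01; rewrite /cintegral /Rintegral.
have -> : (\int[mu]_(t in `[a, 1%R]) (complex.Re (p * cpow t (p - 1)))%:E =
    (complex.Re (1 - cpow a p))%:E)%E.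
  rewrite -[in RHS](mul1r (1 - _)) -integral_Re_cpow//.
  by apply: eq_integral => t _; rewrite mul1r.
have ReN'i (w : R[i]) : complex.Re (- 'i * w) = complex.Im w.
  by case: w => x y /=; rewrite oppr0 mul0r mulN1r opprK add0r.
have -> : (\int[mu]_(t in `[a, 1%R]) (complex.Im (p * cpow t (p - 1)))%:E =
    (complex.Im (1 - cpow a p))%:E)%E.
  rewrite -[in RHS]ReN'i -integral_Re_cpow//.
  by apply: eq_integral => t _; rewrite ReN'i.
by case: (1 - cpow a p).
Qed.

(** Splitting ]0, 1[ at a and rescaling ]0, a[ onto ]0, 1[ gives
B(p, 1) = a^p B(p, 1) + (1 - a^p) / p, so that no improper integral has to be
computed. *)
Lemma cbeta1 p : 0 < complex.Re p -> cbeta p 1 = p^-1.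
Proof.
move=> p0; pose a : R := 2^-1.
have a01 : 0 < a < 1 by rewrite /a; lra.
have /andP[a0 a1] := a01.
have pN0 : p != 0 by apply: contraTneq p0 => ->; rewrite /= ltxx.
have ib := cintegrable_beta_kernel p0 (@ltr01 R : 0 < complex.Re (1 : R[i])).
have mb := cmeasurable_beta_kernel p 1.
pose f1 t := if t < a then beta_kernel p 1 t else 0.
pose f2 t := if a <= t then beta_kernel p 1 t else 0.
have bd : (\int[mu]_(t in setT) (normc (beta_kernel p 1 t))%:E < +oo)%E.
  by apply: beta_mass_lty => //; rewrite /= ltr01.
have mif (b : R -> bool) : measurable_fun setT b ->
    cmeasurable (fun t => if b t then beta_kernel p 1 t else 0).
  by move=> ?; apply: cmeasurable_if => //; exact: cmeasurable_cst.
have sub (b : R -> bool) : measurable_fun setT b ->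
    cintegrable setT (fun t => if b t then beta_kernel p 1 t else 0).
  move=> /mif mf; apply: cintegrable_normc => //.
  apply: le_lt_trans bd; apply: ge0_le_integral => //.
  - by move=> t _; rewrite lee_fin normc_ge0.
  - exact/measurable_EFinP/measurable_normc.
  - exact/measurable_EFinP/measurable_normc.
  - by move=> t _; rewrite lee_fin; case: ifP => _ //; rewrite Normc.normc0 normc_ge0.
have if1 : cintegrable setT f1 by apply: sub; exact: measurable_fun_ltr.
have if2 : cintegrable setT f2 by apply: sub; exact: measurable_fun_ler.
have split : cbeta p 1 = cintegral setT f1 + cintegral setT f2.
  rewrite -cintegralD//; apply: eq_cintegral => t _.
  by rewrite /f1 /f2; case: (leP a t) => _; rewrite ?addr0 ?add0r.
have If1 : cintegral setT f1 = cpow a p * cbeta p 1.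
  rewrite (cintegral_affine 0 a0); last by apply: mif; exact: measurable_fun_ltr.
  rewrite -cintegralZl//; apply: eq_cintegral => t _.
  rewrite /f1 /beta_kernel addr0 subrr !cpow0 !mulr1.
  rewrite pmulr_rgt0// -[X in a * t < X]mulr1 ltr_pM2l//.
  have [t1|t1] := ltP t 1; last by rewrite andbF !mulr0.
  rewrite andbT; have [t0|t0] /= := ltP 0 t; last by rewrite !mulr0.
  have at1 : a * t < 1 by nra.
  by rewrite at1 cpowM// mulrA -cpowB1.
have If2 : p * cintegral setT f2 = 1 - cpow a p.
  rewrite -cintegral_cpow// -cintegralZl//.
  transitivity (cintegral `[a, 1[ (fun t => p * cpow t (p - 1))).
    rewrite [RHS]cintegral_mkcond; apply: eq_cintegral => t _.
    rewrite /f2 /beta_kernel subrr cpow0 mulr1 mem_setE in_itv /=.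
    have [at_|_] /= := leP a t; last by rewrite mulr0.
    by rewrite (lt_le_trans a0 at_) /=; case: ifP => _; rewrite ?mulr0.
  have [rm jm] := cmeasurableM (cmeasurable_cst R p) (cmeasurable_cpow (p - 1)).
  rewrite /cintegral /Rintegral !integral_itv_bndo_bndc//.
  - exact/measurable_EFinP/measurable_funTS.
  - exact/measurable_EFinP/measurable_funTS.
have ne : 1 - cpow a p != 0.
  rewrite subr_eq0; apply/eqP => /(congr1 (@Normc.normc R)).
  rewrite Normc.normc1 normc_cpow -expR0 => /expR_inj/esym/eqP.
  by rewrite mulf_eq0 (gt_eqF p0) (lt_eqF (ln_lt0 a01)).
apply: (mulfI pN0); rewrite divff//; apply: (mulIf ne); rewrite mul1r -[RHS]If2.
have -> : cintegral setT f2 = cbeta p 1 - cpow a p * cbeta p 1.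
  by rewrite {1}split If1 addrC addKr.
by ring.
Qed.

Lemma Gamma_integral1 : Gamma_integral 1 = 1 :> R[i].
Proof.
have -> : Gamma_integral 1 = cintegral setT (fun t : R =>
    (if t \in `]0, +oo[%classic then expR (- t) else 0)%:C).
  rewrite /Gamma_integral cintegral_mkcond; apply: eq_cintegral => t _.
  by case: ifP => _ //; rewrite subrr cpow0 mul1r.
rewrite /cintegral /= [X in _ +i* X]Rintegral_cst// mul0r.
congr (_ +i* 0).
have mE : measurable_fun setT (fun t : R => (expR (- t))%:E).
  by apply/measurable_EFinP; exact: measurableT_comp.
have I1 : (\int[mu]_(t in `]0%R, +oo[) (expR (- t))%:E = 1)%E.
  rewrite integral_itv_obnd_cbnd; last exact: measurable_funTS.
  rewrite -(@integral_exponential_pdf R 1 ltr01) integral_mkcond.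
  apply: eq_integral => t _; rewrite /exponential_pdf !patchE.
  by case: ifP => // _; rewrite mul1r mulN1r.
rewrite /Rintegral -[1 in RHS](_ : fine 1%E = 1)// -I1 [in RHS]integral_mkcond.
by congr fine; apply: eq_integral => t _; rewrite patchE; case: ifP.
Qed.

(** Euler's formula with q = 1. *)
Lemma Gamma_integralS p : 0 < complex.Re p ->
  Gamma_integral (p + 1) = p * Gamma_integral p.
Proof.
move=> p0; have h1 : 0 < complex.Re (1 : R[i]) by rewrite /= ltr01.
have pN0 : p != 0 by apply: contraTneq p0 => ->; rewrite /= ltxx.
have := Gamma_integralM p0 h1; rewrite Gamma_integral1 mulr1 cbeta1// => ->.
by rewrite mulrC divfK.
Qed.

(** Gamma (Re p), as a real number. *)
Definition rgamma p : R := fine (gamma_mass p).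

Lemma rgammaE p : 0 < complex.Re p -> (rgamma p)%:E = gamma_mass p.
Proof.
by move=> p0; rewrite fineK// ge0_fin_numE ?gamma_mass_ge0 ?gamma_mass_lty.
Qed.

Lemma rgamma_gt0 p : 0 < complex.Re p -> 0 < rgamma p.
Proof. by move=> p0; rewrite -lte_fin rgammaE// gamma_mass_gt0. Qed.

Lemma eq_rgamma p q : complex.Re p = complex.Re q -> rgamma p = rgamma q.
Proof. by move=> pq; rewrite /rgamma (eq_gamma_mass pq). Qed.

Lemma normc_Gamma_integral_le p : 0 < complex.Re p ->
  normc (Gamma_integral p) <= rgamma p.
Proof.
move=> p0; rewrite Gamma_integralE -lee_fin rgammaE//.
apply: normc_cintegral_le => //; first exact: cmeasurable_gamma_kernel.
exact: gamma_mass_lty.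
Qed.

Lemma Gamma_integral_real (r : R) : 0 < r -> Gamma_integral r%:C = (rgamma r%:C)%:C.
Proof.
move=> r0; have kE s : gamma_kernel r%:C s = (normc (gamma_kernel r%:C s))%:C.
  rewrite normc_gamma_kernel /gamma_kernel; case: ifP => // s0.
  by rewrite -(rmorphB _ r 1) cpow_real// -rmorphM /= /powR gt_eqF// -expRD.
rewrite Gamma_integralE /cintegral; under eq_Rintegral do rewrite kE /=.
under [X in _ +i* X]eq_Rintegral do rewrite kE /=.
by rewrite [X in _ +i* X]Rintegral_cst// mul0r.
Qed.

Lemma rgammaS p : 0 < complex.Re p -> rgamma (p + 1) = complex.Re p * rgamma p.
Proof.
move=> p0; set r := complex.Re p.
have r10 : 0 < r + 1 by rewrite addr_gt0.
rewrite (@eq_rgamma p r%:C)// (@eq_rgamma (p + 1) (r + 1)%:C) ?Re_add//.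
apply: (@complexI R); rewrite rmorphM /= -!Gamma_integral_real//.
by rewrite rmorphD rmorph1 Gamma_integralS.
Qed.

Lemma sin_le x : 0 <= x -> `|sin x| <= x :> R.
Proof.
move=> x0; have [t _] : exists2 t, t \in `[0, x] & sin x - sin 0 = cos t * (x - 0).
  apply: MVT_segment => //.
  by apply: continuous_subspaceT; exact: continuous_sin.
rewrite sin0 !subr0 => ->; rewrite normrM (ger0_norm x0).
by rewrite ler_piMl// cos_max.
Qed.

Lemma cos_ge x : 1 - x ^+ 2 / 2 <= cos x :> R.
Proof.
wlog x0 : x / 0 <= x => [h|].
  have [/h//|/ltW x0] := leP 0 x.
  by have := h (- x); rewrite cosN sqrrN; apply; rewrite oppr_ge0.
have -> : cos x = 1 - (sin (x / 2)) ^+ 2 * 2.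
  have {1}-> : x = (x / 2) *+ 2 by rewrite -mulr_natr divfK.
  by rewrite cos_mulr2n sin2cos2 mulr2n; ring.
have h : sin (x / 2) ^+ 2 <= (x / 2) ^+ 2.
  rewrite -real_normK ?num_real//; apply: lerXn2r; rewrite ?nnegrE//.
    by rewrite divr_ge0.
  by apply: sin_le; rewrite divr_ge0.
by move: h; rewrite expr_div_n; lra.
Qed.

(** By symmetry u >= 1. With v = sqrt u, ln u = 2 ln v <= 2 (v - 1), while the right
side is 4 ((v - 1) (v + 1) / v)^2. The moments of the bound against the Gamma
density only involve the shifts by -1, 0 and 1. *)
Lemma ln_sqr_le u : 0 < u -> (ln u) ^+ 2 <= 4 * (u - 2 + u^-1).
Proof.
wlog u1 : u / 1 <= u => [h u0|u0].
  have [/h|/ltW u1] := leP 1 u; first exact.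
  have := h u^-1; rewrite invf_ge1// invr_gt0 => /(_ u1 u0).
  by rewrite lnV ?posrE// sqrrN invrK; lra.
pose v := Num.sqrt u; have v0 : 0 < v by rewrite sqrtr_gt0.
have uE : u = v ^+ 2 by rewrite sqr_sqrtr// ltW.
have v1 : 1 <= v by rewrite -sqrtr1 ler_wsqrtr.
rewrite uE lnXn//.
have l0 : 0 <= ln v by exact: ln_ge0.
have l1 : ln v <= v - 1.
  by have := @le_ln1Dx R (v - 1); rewrite subrKC; apply; lra.
have h1 : (ln v *+ 2) ^+ 2 <= 4 * (v - 1) ^+ 2.
  by rewrite mulr2n; nra.
apply: (le_trans h1); rewrite ler_pM2l//.
have -> : v ^+ 2 - 2 + (v ^+ 2)^-1 = (v - 1) ^+ 2 * ((v + 1) / v) ^+ 2.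
  by field; rewrite gt_eqF.
rewrite ler_peMr ?sqr_ge0// -[leLHS](expr1n _ 2); apply: lerXn2r; rewrite ?nnegrE//.
  by rewrite divr_ge0 ?addr_ge0// ltW.
by rewrite ler_pdivlMr// mul1r lerDl.
Qed.

End gamma_functional_equation.

(** * Modulus of Gamma along a vertical line *)

Section gamma_modulus.
Context {R : realType}.
Notation mu := (@lebesgue_measure R).
Notation normc := Normc.normc.
Implicit Types (p q z : R[i]) (s t u : R).

Lemma integrable_normc_gamma_kernel p : 0 < complex.Re p ->
  mu.-integrable setT (fun s => (normc (gamma_kernel p s))%:E).
Proof.
move=> p0; apply/integrableP; split.
  exact/measurable_EFinP/measurable_normc/cmeasurable_gamma_kernel.
under eq_integral do rewrite /= ger0_norm ?normc_ge0//.
exact: gamma_mass_lty.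
Qed.

Lemma normc_gamma_kernelD p (r : R) s : 0 < s ->
  normc (gamma_kernel (p + r%:C) s) = normc (gamma_kernel p s) * s `^ r.
Proof.
move=> s0; rewrite !normc_gamma_kernel s0 /powR gt_eqF// -expRD Re_add /=.
by congr expR; ring.
Qed.

(** The density s^(r-1) e^(-s) concentrates around s = r. After multiplication by
the phase r^(-iv), the integrand of Gamma (r + iv) has real part
s^(r-1) e^(-s) cos (v ln (s / r)), and
cos (v ln (s / r)) >= 1 - 2 v^2 (s / r - 2 + r / s), whose mean is explicit. *)
Lemma Gamma_integral_concentration z : 1 < complex.Re z ->
  rgamma z * (1 - 2 * complex.Im z ^+ 2 / (complex.Re z - 1)) <=
  normc (Gamma_integral z).
Proof.
set r := complex.Re z; set v := complex.Im z => r1.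
have r0 : 0 < r by lra.
pose c : R[i] := cexp (0 +i* (- (v * ln r))).
have nc : normc c = 1 by rewrite /c normc_cexp expR0.
have -> : normc (Gamma_integral z) = normc (c * Gamma_integral z).
  by rewrite Normc.normcM nc mul1r.
rewrite Gamma_integralE.
have mz := @cmeasurable_gamma_kernel R z.
rewrite -cintegralZl//; last exact: cintegrable_gamma_kernel.
apply: le_trans (le_trans (ler_norm _) (ler_norm_Re _)).
have pointwise s : normc (gamma_kernel z s) * (1 + 4 * v ^+ 2)
    - 2 * v ^+ 2 / r * normc (gamma_kernel (z + 1%:C) s)
    - 2 * v ^+ 2 * r * normc (gamma_kernel (z + (- 1)%:C) s)
    <= complex.Re (c * gamma_kernel z s).
  have [s0|s0] := ltP 0 s; last first.
    by rewrite !gamma_kernel_le0// Normc.normc0 !(mul0r, mulr0, subr0).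
  have -> : complex.Re (c * gamma_kernel z s) =
      normc (gamma_kernel z s) * cos (v * ln (s / r)).
    rewrite normc_gamma_kernel /gamma_kernel s0 /cpow mulrA -cexpD.
    have cexpR w (k : R) : complex.Re (cexp w * (expR k)%:C) =
        expR (complex.Re w + k) * cos (complex.Im w).
      by rewrite expRD /cexp !Re_mul Im_mul /=; ring.
    rewrite cexpR Re_add Im_add Re_mul Im_mul Re_add Im_add /= -/r -/v.
    by rewrite ln_div ?posrE//; congr (expR _ * cos _); ring.
  rewrite (normc_gamma_kernelD z 1 s0) (normc_gamma_kernelD z (- 1) s0).
  rewrite powRr1 ?(ltW s0)// powR_inv1 ?(ltW s0)//.
  set n := normc _; have n0 : 0 <= n by exact: normc_ge0.
  apply: (@le_trans _ _ (n * (1 - (v * ln (s / r)) ^+ 2 / 2))); last first.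
    by rewrite ler_wpM2l// cos_ge.
  have -> : n * (1 + 4 * v ^+ 2) - 2 * v ^+ 2 / r * (n * s) - 2 * v ^+ 2 * r * (n * s^-1) =
      n * (1 - v ^+ 2 * (4 * (s / r - 2 + (s / r)^-1)) / 2).
    by field; rewrite !gt_eqF.
  rewrite ler_wpM2l// lerD2l lerN2 ler_pM2r ?invr_gt0// exprMn.
  by rewrite ler_wpM2l ?sqr_ge0// ln_sqr_le// divr_gt0.
have zm1 : 0 < complex.Re (z + (- 1)%:C) by rewrite Re_add /= subr_gt0.
have zp1 : 0 < complex.Re (z + 1%:C) by rewrite Re_add /= addr_gt0.
have iZ p k : 0 < complex.Re p ->
    mu.-integrable setT (fun s => (k * normc (gamma_kernel p s))%:E).
  move=> p0; under eq_fun do rewrite EFinM; apply: integrableZl => //.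
  exact: integrable_normc_gamma_kernel.
have iB (f g : R -> R) : mu.-integrable setT (fun s => (f s)%:E) ->
    mu.-integrable setT (fun s => (g s)%:E) ->
    mu.-integrable setT (fun s => (f s - g s)%:E).
  by move=> ? ?; under eq_fun do rewrite EFinB; exact: integrableB.
have iz : mu.-integrable setT (fun s => (normc (gamma_kernel z s) * (1 + 4 * v ^+ 2))%:E).
  by under eq_fun do rewrite mulrC; exact: iZ.
apply: (@le_trans _ _ (Rintegral mu setT (fun s => normc (gamma_kernel z s) * (1 + 4 * v ^+ 2)
    - 2 * v ^+ 2 / r * normc (gamma_kernel (z + 1%:C) s)
    - 2 * v ^+ 2 * r * normc (gamma_kernel (z + (- 1)%:C) s)))); last first.
  apply: le_Rintegral => //.
  - exact: iB (iB _ _ iz (iZ _ _ zp1)) (iZ _ _ zm1).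
  - apply: (@cintegrable_normc _ _ (fun s => c * gamma_kernel z s) _ _ _).1 => //.
      by apply: cmeasurableM => //; exact: cmeasurable_cst.
    under eq_integral do rewrite Normc.normcM nc mul1r.
    exact: gamma_mass_lty.
rewrite RintegralB//; [|exact: iB iz (iZ _ _ zp1)|exact: iZ].
rewrite RintegralB//; last exact: iZ.
rewrite RintegralZr ?RintegralZl//; try exact: integrable_normc_gamma_kernel.
have rE p : Rintegral mu setT (fun s => normc (gamma_kernel p s)) = rgamma p.
  by [].
rewrite !rE.
have zE : z = (z + (- 1)%:C) + 1 by rewrite -addrA -(rmorphD _ (-1) 1) addNr addr0.
have E : rgamma z = (r - 1) * rgamma (z + (- 1)%:C).
  by rewrite {1}zE rgammaS// Re_add.
rewrite rgammaS// -/r E le_eqVlt; apply/orP; left; apply/eqP.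
by field; rewrite !gt_eqF ?subr_gt0.
Qed.

(** Along a vertical line |Gamma| is comparable with its value at the real part.
Far to the right this is the previous concentration estimate; the functional
equation carries it down to any positive abscissa. *)
Lemma Gamma_integral_ge (v s0 : R) : 0 < s0 -> exists2 c, 0 < c &
  forall z, complex.Im z = v -> s0 <= complex.Re z ->
    c * rgamma z <= normc (Gamma_integral z).
Proof.
move: s0; suff H (k : nat) : forall s0, 0 < s0 -> 2 + 4 * v ^+ 2 <= s0 + k%:R ->
    exists2 c, 0 < c & forall z, complex.Im z = v -> s0 <= complex.Re z ->
    c * rgamma z <= normc (Gamma_integral z).
  move=> s0 s00; apply: (H (Num.truncn (2 + 4 * v ^+ 2)).+1 _ s00).
  apply: ler_wpDl; first exact: ltW.
  by apply: ltW; apply: truncnS_gt.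
elim: k => [|k IH] s0 s00 hs.
  (* Re z - 1 >= 1 + 4 v^2 makes the correction term at most 1/2 *)
  rewrite addr0 in hs; exists 2^-1 => // z zv sz.
  have v20 : 0 <= v ^+ 2 by exact: sqr_ge0.
  have z1 : 1 < complex.Re z by lra.
  apply: le_trans (Gamma_integral_concentration z1).
  rewrite mulrC; apply: ler_wpM2l; first by rewrite ltW ?rgamma_gt0//; lra.
  have : 2 * complex.Im z ^+ 2 / (complex.Re z - 1) <= 2^-1.
    by rewrite ler_pdivrMr ?subr_gt0// zv; lra.
  lra.
have [||c c0 hc] := IH (s0 + 1).
- by rewrite addr_gt0.
- by move: hs; rewrite -natr1; lra.
(* Gamma (z + 1) = z Gamma z loses the factor Re z / |z|, which is at least
   s0 / (s0 + |v|) *)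
exists (c * (s0 / (s0 + `|v|))).
  by rewrite mulr_gt0// divr_gt0// ltr_wpDr.
move=> z zv sz; set r := complex.Re z in sz *.
have r0 : 0 < r by exact: lt_le_trans sz.
have zN0 : z != 0 by apply: contraTneq r0 => z0; rewrite /r z0 /= ltxx.
have z1v : complex.Im (z + 1) = v by rewrite Im_add /= addr0.
have sz1 : s0 + 1 <= complex.Re (z + 1) by rewrite Re_add lerD2r.
have := hc _ z1v sz1.
rewrite Gamma_integralS// rgammaS// Normc.normcM => h.
rewrite -(ler_pM2l (_ : 0 < normc z)) ?normc_gt0//; apply: le_trans h.
have nz : normc z <= r + `|v|.
  by rewrite (le_trans (normc_le_ReDIm z))// zv lerD2r /r ger0_norm// ltW.
have sv : 0 < s0 + `|v| by rewrite ltr_wpDr.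
have g0 : 0 < rgamma z by exact: rgamma_gt0.
have -> : normc z * (c * (s0 / (s0 + `|v|)) * rgamma z) =
    (c * rgamma z) * (normc z * s0 / (s0 + `|v|)) by field; rewrite gt_eqF.
have -> : c * (complex.Re z * rgamma z) = (c * rgamma z) * r by rewrite /r; ring.
apply: ler_wpM2l; first by rewrite mulr_ge0 ?(ltW c0) ?(ltW g0).
rewrite ler_pdivrMr//.
have := normr_ge0 v; nra.
Qed.

Lemma Gamma_integral_neq0 z : 0 < complex.Re z -> Gamma_integral z != 0.
Proof.
move=> z0; have [c c0 /(_ z erefl (lexx _)) h] := Gamma_integral_ge (complex.Im z) z0.
rewrite -normc_gt0; apply: lt_le_trans h; rewrite mulr_gt0// rgamma_gt0//.
Qed.

End gamma_modulus.

(** * Absolutely summable double series *)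

Section double_series.
Context {R : realType}.
Notation mu := (@lebesgue_measure R).
Notation normc := Normc.normc.
Implicit Types (u : nat -> R[i]) (a : nat -> nat -> R[i]).

(** Convergence in the complex plane, tested on components so that theorems on real
integrals apply. *)
Definition ccvg u (l : R[i]) :=
  ((fun n => complex.Re (u n)) @ \oo --> complex.Re l) /\
  ((fun n => complex.Im (u n)) @ \oo --> complex.Im l).

Lemma ccvg_lim u (l : R[i]) : ccvg u l -> limn (u : nat -> R[i]^o) = l.
Proof.
move=> [rl jl]; apply/cvg_lim; first exact: norm_hausdorff.
apply/cvgrPdist_lt => e; rewrite ltcE => /andP[/eqP ie re].
have e2 : 0 < complex.Re e / 2 by rewrite divr_gt0.
move/cvgrPdist_lt : rl => /(_ _ e2) rl.
move/cvgrPdist_lt : jl => /(_ _ e2) jl.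
near=> n; rewrite normr_normc ltcE /= ie eqxx /=.
apply: le_lt_trans (normc_le_ReDIm _) _.
rewrite [ltRHS]splitr ltrD//.
- rewrite (_ : complex.Re _ = complex.Re l - complex.Re (u n)).
    by near: n.
  by rewrite Re_add; case: (u n).
- rewrite (_ : complex.Im _ = complex.Im l - complex.Im (u n)).
    by near: n.
  by rewrite Im_add; case: (u n).
Unshelve. all: by end_near. Qed.

Lemma ccvgZ u l (c : R[i]) : ccvg u l -> ccvg (fun n => c * u n) (c * l).
Proof.
move=> [rl jl]; split.
  under eq_fun do rewrite Re_mul; rewrite Re_mul.
  by apply: cvgB; apply: cvgM => //; exact: cvg_cst.
under eq_fun do rewrite Im_mul; rewrite Im_mul.
by apply: cvgD; apply: cvgM => //; exact: cvg_cst.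
Qed.

Definition square_sum (V : nmodType) (r : nat -> nat -> V) (N : nat) : V :=
  \sum_(0 <= m < N) \sum_(0 <= n < N) r m n.

Lemma square_sum_nd (r : nat -> nat -> R) : (forall m n, 0 <= r m n) ->
  nondecreasing_seq (square_sum r).
Proof.
move=> r0; apply/nondecreasing_seqP => N; rewrite /square_sum big_nat_recr//=.
apply: ler_wpDr; first exact: sumr_ge0.
by apply: ler_sum => m _; rewrite big_nat_recr//= lerDl.
Qed.

(** r = (r + |r|) - |r|, a difference of two nonnegative families with bounded
square sums. *)
Lemma cvg_square_sum (r : nat -> nat -> R) (M : R) :
  (forall N, square_sum (fun m n => `|r m n|) N <= M) -> cvgn (square_sum r).
Proof.
move=> rM; have pos (h : nat -> nat -> R) K : (forall m n, 0 <= h m n) ->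
    (forall N, square_sum h N <= K) -> cvgn (square_sum h).
  move=> h0 hK; apply: nondecreasing_is_cvgn; first exact: square_sum_nd.
  by exists K => _ [N _ <-].
have c1 : cvgn (square_sum (fun m n => `|r m n|)) by apply: pos rM => *.
have c2 : cvgn (square_sum (fun m n => r m n + `|r m n|)).
  apply: (pos _ (M + M)) => [m n|N].
    by rewrite -lerBlDr sub0r lerNl -normrN ler_norm.
  apply: le_trans (lerD (rM N) (rM N)); rewrite -big_split /=.
  apply: ler_sum => m _; rewrite -big_split /=.
  by apply: ler_sum => n _; rewrite lerD2r ler_norm.
rewrite (_ : square_sum r =
  square_sum (fun m n => r m n + `|r m n|) - square_sum (fun m n => `|r m n|)).
  exact: is_cvgB.
apply/funext => N; rewrite fctE /square_sum -sumrB.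
by apply: eq_bigr => m _; rewrite -sumrB; apply: eq_bigr => n _; rewrite addrK.
Qed.

Lemma Re_sum (I : Type) (s : seq I) (f : I -> R[i]) :
  complex.Re (\sum_(i <- s) f i) = \sum_(i <- s) complex.Re (f i).
Proof. by elim/big_ind2 : _ => // ? ? ? ? <- <-; rewrite Re_add. Qed.

Lemma Im_sum (I : Type) (s : seq I) (f : I -> R[i]) :
  complex.Im (\sum_(i <- s) f i) = \sum_(i <- s) complex.Im (f i).
Proof. by elim/big_ind2 : _ => // ? ? ? ? <- <-; rewrite Im_add. Qed.

Lemma Re_square_sum a N : complex.Re (square_sum a N) =
  square_sum (fun m n => complex.Re (a m n)) N.
Proof. by rewrite Re_sum; apply: eq_bigr => m _; rewrite Re_sum. Qed.

Lemma Im_square_sum a N : complex.Im (square_sum a N) =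
  square_sum (fun m n => complex.Im (a m n)) N.
Proof. by rewrite Im_sum; apply: eq_bigr => m _; rewrite Im_sum. Qed.

Lemma square_sum_le_esum (r : nat -> nat -> \bar R) N :
  (forall m n, 0 <= r m n)%E ->
  (\sum_(0 <= m < N) \sum_(0 <= n < N) r m n <=
   \esum_(p in [set: nat * nat]) r p.1 p.2)%E.
Proof.
move=> r0; apply: esum_ge.
pose s := [seq (m, n) | m <- index_iota 0 N, n <- index_iota 0 N].
exists [set` s]; first by split => //; exact: finite_seq.
rewrite -fsbig_seq; last by apply: allpairs_uniq => [||[? ?] [? ?]]//; exact: iota_uniq.
by rewrite big_allpairs.
Qed.

Lemma abs_summable2_bound a : abs_summable2 a ->
  exists M, forall N, square_sum (fun m n => normc (a m n)) N <= M.
Proof.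
rewrite /abs_summable2; set S := esum _ _ => Soo.
have aE m n : complex.Re `|a m n| = normc (a m n) by rewrite normr_normc.
have S0 : (0 <= S)%E.
  by apply: esum_ge0 => p _; rewrite lee_fin aE normc_ge0.
exists (fine S) => N; rewrite -lee_fin fineK ?ge0_fin_numE//.
apply: le_trans (@square_sum_le_esum (fun m n => (complex.Re `|a m n|)%:E) N _).
  rewrite /square_sum -sumEFin; apply: lee_sum => m _; rewrite -sumEFin.
  by apply: lee_sum => n _; rewrite aE.
by move=> m n; rewrite lee_fin aE normc_ge0.
Qed.

Lemma abs_summable2_ccvg a : abs_summable2 a -> ccvg (square_sum a) (series2 a).
Proof.
move=> /abs_summable2_bound[M aM].
have cr : cvgn (square_sum (fun m n => complex.Re (a m n))).
  apply: (@cvg_square_sum _ M) => N; apply: le_trans (aM N).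
  by do 2 apply: ler_sum => ? _; exact: ler_norm_Re.
have ci : cvgn (square_sum (fun m n => complex.Im (a m n))).
  apply: (@cvg_square_sum _ M) => N; apply: le_trans (aM N).
  by do 2 apply: ler_sum => ? _; exact: ler_norm_Im.
have c : ccvg (square_sum a) (limn (square_sum (fun m n => complex.Re (a m n)))
    +i* limn (square_sum (fun m n => complex.Im (a m n)))).
  split; first by under eq_fun do rewrite Re_square_sum.
  by under eq_fun do rewrite Im_square_sum.
by rewrite /series2 (ccvg_lim c).
Qed.

Lemma series2_ccvg a l : ccvg (square_sum a) l -> series2 a = l.
Proof. exact: ccvg_lim. Qed.

(** Termwise integration: the square sums of the moduli form the dominating
function, which is integrable because its integral is the supremum of the
square sums of the integrals of the moduli. *)
Lemma ccvg_cintegral_series (D : set R) (f : nat -> nat -> R -> R[i])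
    (F : R -> R[i]) (M : R) : measurable D ->
  (forall m n, cmeasurable (f m n)) ->
  (forall N, \sum_(0 <= m < N) \sum_(0 <= n < N)
     \int[mu]_(t in D) (normc (f m n t))%:E <= M%:E)%E ->
  (forall t, D t -> ccvg (square_sum (fun m n => f m n t)) (F t)) ->
  cintegrable D F /\
  ccvg (square_sum (fun m n => cintegral D (f m n))) (cintegral D F).
Proof.
move=> mD mf fM fF.
have mnf m n : measurable_fun D (fun t => (normc (f m n t))%:E).
  exact/measurable_EFinP/measurable_funTS/measurable_normc.
pose g N t := (square_sum (fun m n => normc (f m n t)) N)%:E.
have gE N t : g N t = (\sum_(0 <= m < N) \sum_(0 <= n < N) (normc (f m n t))%:E)%E.
  by rewrite /g /square_sum -sumEFin; apply: eq_bigr => m _; rewrite -sumEFin.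
have g0 N t : (0 <= g N t)%E.
  by rewrite lee_fin; do 2 apply: sumr_ge0 => ? _; exact: normc_ge0.
have mg N : measurable_fun D (g N).
  rewrite (_ : g N = fun t => \sum_(0 <= m < N) \sum_(0 <= n < N) (normc (f m n t))%:E)%E.
    by apply: emeasurable_sum => m; exact: emeasurable_sum.
  by apply/funext => t; exact: gE.
have ndg t : {homo g ^~ t : n m / (n <= m)%N >-> (n <= m)%E}.
  by move=> n m nm; rewrite lee_fin; apply: square_sum_nd => // *; exact: normc_ge0.
pose G t := limn (g ^~ t).
have gG N t : (g N t <= G t)%E.
  rewrite /G (cvg_lim _ (ereal_nondecreasing_cvgn (ndg t)))//.
  by apply: ereal_sup_ubound; exists N.
have fin m n : (\int[mu]_(t in D) (normc (f m n t))%:E < +oo)%E.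
  apply: (@le_lt_trans _ _ M%:E); last exact: ltry.
  have le_big (h : nat -> \bar R) k N : (k < N)%N -> (forall i, 0 <= h i)%E ->
      (h k <= \sum_(0 <= i < N) h i)%E.
    move=> kN h0; rewrite (bigD1_seq k) ?mem_index_iota ?iota_uniq//=.
    by rewrite leeDl// sume_ge0.
  have i0 k l : (0 <= \int[mu]_(t in D) (normc (f k l t))%:E)%E.
    by apply: integral_ge0 => t _; rewrite lee_fin normc_ge0.
  apply: le_trans (fM (maxn m n).+1).
  apply: le_trans (le_big _ n _ _ (i0 m)) (le_big _ m _ _ _).
  - by rewrite ltnS leq_maxr.
  - by rewrite ltnS leq_maxl.
  - by move=> k; exact: sume_ge0.
have iG : mu.-integrable D G.
  apply/integrableP; split.
    apply: (emeasurable_fun_cvg _ _ mg) => t _.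
    exact: (ereal_nondecreasing_is_cvgn (ndg t)).
  under eq_integral do rewrite gee0_abs ?(le_trans (g0 0%N _) (gG 0%N _))//.
  rewrite /G monotone_convergence//.
  apply: (@le_lt_trans _ _ M%:E); last exact: ltry.
  apply: lime_le.
    apply: ereal_nondecreasing_is_cvgn => n m nm.
    apply: ge0_le_integral => //; try exact: mg.
    by move=> t _; exact: ndg.
  apply: nearW => N; apply: le_trans (fM N).
  under eq_integral do rewrite gE.
  rewrite ge0_integral_sum//; last 2 first.
  - by move=> m; apply: emeasurable_sum => n; exact: mnf.
  - by move=> m t _; apply: sume_ge0 => n _; rewrite lee_fin normc_ge0.
  apply: lee_sum => m _; rewrite ge0_integral_sum//; first exact: mnf.
  by move=> n t _; rewrite lee_fin normc_ge0.
have dom (h : R[i] -> R) : (forall z, `|h z| <= normc z) -> h 0 = 0 ->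
    {morph h : x y / x + y} ->
    (forall m n, measurable_fun setT (fun t => h (f m n t))) ->
    (forall t, D t -> (fun N => h (square_sum (fun m n => f m n t) N)) @ \oo --> h (F t)) ->
    mu.-integrable D (fun t => (h (F t))%:E) /\
    (fun N => square_sum (fun m n => Rintegral mu D (fun t => h (f m n t))) N) @ \oo
      --> Rintegral mu D (fun t => h (F t)).
  move=> hn h0 hD mh hF.
  have hs N t : h (square_sum (fun m n => f m n t) N) =
      square_sum (fun m n => h (f m n t)) N.
    rewrite /square_sum (big_morph h hD h0); apply: eq_bigr => m _.
    by rewrite (big_morph h hD h0).
  pose hN N t := (h (square_sum (fun m n => f m n t) N))%:E.
  have ih m n : mu.-integrable D (fun t => (h (f m n t))%:E).
    apply/integrableP; split; first by apply/measurable_EFinP; apply: measurable_funTS; exact: mh.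
    apply: le_lt_trans (fin m n); apply: ge0_le_integral => //=.
    - apply/measurable_EFinP; apply: measurableT_comp => //.
      by apply: measurable_funTS; exact: mh.
    - exact: mnf.
    - by move=> t _; rewrite lee_fin.
  have hNE N t : hN N t = (\sum_(0 <= m < N) \sum_(0 <= n < N) (h (f m n t))%:E)%E.
    by rewrite /hN hs /square_sum -sumEFin; apply: eq_bigr => m _; rewrite -sumEFin.
  have mhN N : measurable_fun D (hN N).
    rewrite (_ : hN N = fun t => \sum_(0 <= m < N) \sum_(0 <= n < N) (h (f m n t))%:E)%E.
      apply: emeasurable_sum => m; apply: emeasurable_sum => n.
      by apply/measurable_EFinP; apply: measurable_funTS; exact: mh.
    by apply/funext => t; exact: hNE.
  have hNF t : D t -> hN ^~ t @ \oo --> (h (F t))%:E.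
    by move=> Dt; apply/cvg_EFin; [exact: nearW|exact: hF].
  have [|||i1 _ i2] := @dominated_convergence _ _ _ mu D mD hN
    (fun t => (h (F t))%:E) G mhN _ _ iG _.
  - exact: (emeasurable_fun_cvg _ _ mhN).
  - by apply: aeW => t; exact: hNF.
  - apply: aeW => t N Dt; apply: le_trans (gG N t).
    rewrite lee_fin hs; apply: le_trans (ler_norm_sum _ _ _) _.
    apply: ler_sum => m _; apply: le_trans (ler_norm_sum _ _ _) _.
    by apply: ler_sum.
  split => //; have iF : (\int[mu]_(t in D) (h (F t))%:E)%E \is a fin_num.
    exact: integrable_fin_num.
  rewrite (_ : (fun N => _) = fine \o (fun N => \int[mu]_(t in D) hN N t)%E).
    by apply: fine_cvg; rewrite fineK.
  apply/funext => N /=; under eq_integral do rewrite hNE.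
  rewrite integral_sum//; last first.
    by move=> m; apply: integrable_sum => // n _; exact: ih.
  rewrite -[LHS]/(fine _%:E); congr fine; rewrite /square_sum -sumEFin.
  apply: eq_bigr => m _; rewrite integral_sum// -sumEFin; apply: eq_bigr => n _.
  by rewrite /Rintegral fineK//; exact: integrable_fin_num.
have [||||i1 c1] := dom (@complex.Re R) (@ler_norm_Re R).
- by [].
- exact: Re_add.
- by move=> m n; exact: (mf m n).1.
- by move=> t /fF[].
have [||||i2 c2] := dom (@complex.Im R) (@ler_norm_Im R).
- by [].
- exact: Im_add.
- by move=> m n; exact: (mf m n).2.
- by move=> t /fF[].
split; first by split.
split.
- by under eq_fun do rewrite Re_square_sum.
- by under eq_fun do rewrite Im_square_sum.
Qed.

End double_series.

(** * Term-by-term integration *)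

Section euler_integral_of_terms.
Context {R : realType}.
Notation mu := (@lebesgue_measure R).
Notation normc := Normc.normc.
Implicit Types (p q z : R[i]) (s t u : R).

Lemma Gamma_Re_gt0 z : 0 < complex.Re z -> Gamma z = Gamma_integral z.
Proof.
by move=> z0; rewrite /Gamma /Gamma_shift z0 addr0 big_geq// divr1.
Qed.

Lemma poch_Re_gt0 z (l : R) : 0 < complex.Re z -> 0 <= l ->
  poch z l = Gamma_integral (z + l%:C) / Gamma_integral z.
Proof.
move=> z0 l0; rewrite /poch asboolF; last first.
  move=> [k zk]; move: z0; rewrite zk -(rmorph_nat (real_complex R)) /=.
  by rewrite oppr_gt0 ltNge ler0n.
by rewrite !Gamma_Re_gt0// Re_add /= ltr_wpDr.
Qed.

Lemma rbetaE p q : 0 < complex.Re p -> 0 < complex.Re q ->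
  beta_mass p q = (rgamma p * rgamma q / rgamma (p + q))%:E.
Proof.
move=> p0 q0; have pq0 : 0 < complex.Re (p + q) by rewrite Re_add addr_gt0.
have bf : (beta_mass p q \is a fin_num)%E.
  by rewrite ge0_fin_numE ?beta_mass_ge0 ?beta_mass_lty.
have := gamma_massM p q; rewrite -!rgammaE// -[beta_mass p q]fineK// -!EFinM.
by move=> [] ->; congr EFin; field; rewrite gt_eqF// rgamma_gt0.
Qed.

(** The termwise integrals of the moduli are controlled by the moduli of the
termwise integrals, uniformly over shifts of the parameters by positive reals:
this is what lets the absolute convergence of the integrated series alone
justify integrating term by term. *)
Lemma beta_mass_le p q : 0 < complex.Re p -> 0 < complex.Re q ->
  exists2 K : R, 0 < K & forall k l : R, 0 <= k -> 0 <= l ->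
    (beta_mass (p + k%:C)%R (q + l%:C)%R <=
     (K * normc (cbeta (p + k%:C) (q + l%:C)))%:E)%E.
Proof.
move=> p0 q0.
have [c c0 hc] := Gamma_integral_ge (complex.Im p) p0.
have [c' c'0 hc'] := Gamma_integral_ge (complex.Im q) q0.
exists (c * c')^-1; first by rewrite invr_gt0 mulr_gt0.
move=> k l k0 l0; set P := p + k%:C; set Q := q + l%:C.
have P0 : 0 < complex.Re P by rewrite Re_add /= ltr_wpDr.
have Q0 : 0 < complex.Re Q by rewrite Re_add /= ltr_wpDr.
have PQ0 : 0 < complex.Re (P + Q) by rewrite Re_add addr_gt0.
have hP : c * rgamma P <= normc (Gamma_integral P).
  by apply: hc; rewrite ?Re_add ?Im_add /= ?addr0 ?lerDl.
have hQ : c' * rgamma Q <= normc (Gamma_integral Q).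
  by apply: hc'; rewrite ?Re_add ?Im_add /= ?addr0 ?lerDl.
have gP := rgamma_gt0 P0; have gQ := rgamma_gt0 Q0; have gPQ := rgamma_gt0 PQ0.
rewrite rbetaE// lee_fin ler_pdivrMr// mulrAC -mulrA ler_pdivlMl ?mulr_gt0//.
apply: (@le_trans _ _ (normc (Gamma_integral P) * normc (Gamma_integral Q))).
  rewrite mulrACA; apply: ler_pM => //; rewrite mulr_ge0// ltW//.
rewrite -Normc.normcM Gamma_integralM// Normc.normcM.
by apply: ler_wpM2r; [exact: normc_ge0|exact: normc_Gamma_integral_le].
Qed.

Lemma cbetaE p q : 0 < complex.Re p -> 0 < complex.Re q ->
  cbeta p q = Gamma_integral p * Gamma_integral q / Gamma_integral (p + q).
Proof.
move=> p0 q0; have pq0 : 0 < complex.Re (p + q) by rewrite Re_add addr_gt0.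
by rewrite Gamma_integralM// mulrC mulKf// Gamma_integral_neq0.
Qed.

End euler_integral_of_terms.

Theorem mainTheorem10 (R : realType)
    (g1 g2 g3 d1 d2 d3 x y : R[i]) (a1 a2 a3 a4 b1 b2 b3 b4 : R)
    (hg3 : 0 < complex.Re g3) (hd1 : complex.Re g3 < complex.Re d1)
    (ha1 : 0 < a1) (ha2 : 0 < a2) (ha3 : 0 < a3) (ha4 : 0 < a4)
    (hb1 : 0 < b1) (hb2 : 0 < b2) (hb3 : 0 < b3) (hb4 : 0 < b4)
    (hb32 : 0 < b3 - b2)
    (hD1 : D1_cvg g1 a1 b1 g2 a2 g3 b2 d1 a3 b3 d2 a4 d3 b4 x y)
    (hE2 : forall t : R, 0 < t < 1 ->
      E2_cvg g1 a1 b1 g2 a2 (d1 - g3) a3 (b3 - b2) d2 a4 d3 b4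
        (x * ((1 - t) `^ a3)%:C)
        (y * (t `^ b2)%:C * ((1 - t) `^ (b3 - b2))%:C)) :
  let F := fun t : R =>
    cpow t (g3 - 1) * cpow (1 - t) (d1 - g3 - 1)
    * E2 g1 a1 b1 g2 a2 (d1 - g3) a3 (b3 - b2) d2 a4 d3 b4
        (x * ((1 - t) `^ a3)%:C)
        (y * (t `^ b2)%:C * ((1 - t) `^ (b3 - b2))%:C) in
  cintegrable `]0, 1[ F /\
  D1 g1 a1 b1 g2 a2 g3 b2 d1 a3 b3 d2 a4 d3 b4 x y
    = (Gamma g3)^-1 * cintegral `]0, 1[ F.
Proof.
move=> F.
set D := `]0, 1[%classic : set R.
have mD : measurable D by exact: measurable_itv.
pose p (n : nat) : R[i] := g3 + (b2 * n%:R)%:C.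
pose q (m n : nat) : R[i] := d1 - g3 + (a3 * m%:R + (b3 - b2) * n%:R)%:C.
have q00 : 0 < complex.Re (d1 - g3).
  by rewrite Re_add; case: (g3) hd1 => ? ? /=; rewrite subr_gt0.
have k0 n : 0 <= b2 * n%:R by rewrite mulr_ge0 ?ler0n// ltW.
have l0 m n : 0 <= a3 * m%:R + (b3 - b2) * n%:R.
  by rewrite addr_ge0 ?mulr_ge0 ?ler0n// ltW.
have p0 n : 0 < complex.Re (p n) by rewrite Re_add /= ltr_wpDr.
have q0 m n : 0 < complex.Re (q m n) by rewrite Re_add /= ltr_wpDr.
have pqE m n : p n + q m n = d1 + (a3 * m%:R + b3 * n%:R)%:C.
  rewrite /p /q addrACA subrKC -rmorphD /=; congr (_ + _%:C); ring.
pose C (m n : nat) : R[i] :=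
  poch g1 (a1 * m%:R + b1 * n%:R) * poch g2 (a2 * m%:R)
  * (x ^+ m / Gamma (d2 + (a4 * m%:R)%:C))
  * (y ^+ n / Gamma (d3 + (b4 * n%:R)%:C)).
have G3 : Gamma g3 = Gamma_integral g3 by exact: Gamma_Re_gt0.
have G3N0 : Gamma_integral g3 != 0 by exact: Gamma_integral_neq0.
pose f (m n : nat) t : R[i] := C m n / Gamma_integral (q m n) * beta_kernel (p n) (q m n) t.
have fE t : D t -> forall m n, f m n t =
    cpow t (g3 - 1) * cpow (1 - t) (d1 - g3 - 1) *
    E2_term g1 a1 b1 g2 a2 (d1 - g3) a3 (b3 - b2) d2 a4 d3 b4
        (x * ((1 - t) `^ a3)%:C)
        (y * (t `^ b2)%:C * ((1 - t) `^ (b3 - b2))%:C) m n.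
  rewrite /D /= in_itv /= => /andP[t0 t1] m n.
  have t10 : 0 < 1 - t by rewrite subr_gt0.
  have powC (s r : R) k : 0 < s -> ((s `^ r)%:C : R[i]) ^+ k = cpow s (r * k%:R)%:C.
    move=> s0; rewrite cpow_real// powRrM powR_mulrn ?powR_ge0//.
    by rewrite rmorphXn.
  rewrite /f /E2_term /beta_kernel t0 t1 /= (Gamma_Re_gt0 (q0 m n)).
  rewrite !exprMn !powC//.
  have -> : cpow t (p n - 1) = cpow t (g3 - 1) * cpow t (b2 * n%:R)%:C.
    by rewrite -cpowD; congr cpow; rewrite /p; ring.
  have -> : cpow (1 - t) (q m n - 1) = cpow (1 - t) (d1 - g3 - 1) *
      (cpow (1 - t) (a3 * m%:R)%:C * cpow (1 - t) ((b3 - b2) * n%:R)%:C).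
    by rewrite -!cpowD -rmorphD; congr cpow; rewrite /q; ring.
  by rewrite /C; ring.
have IfB m n : cintegral D (f m n) =
    C m n / Gamma_integral (q m n) * cbeta (p n) (q m n).
  rewrite /cbeta -cintegralZl//; last exact: cintegrable_beta_kernel.
  rewrite cintegral_mkcond; apply: eq_cintegral => t _.
  rewrite mem_setE in_itv /= /f /beta_kernel.
  by case: ifP => t01; rewrite ?t01 ?mulr0.
have If m n : cintegral D (f m n) = Gamma_integral g3 *
    D1_term g1 a1 b1 g2 a2 g3 b2 d1 a3 b3 d2 a4 d3 b4 x y m n.
  rewrite IfB.
  rewrite cbetaE// pqE /D1_term (poch_Re_gt0 hg3 (k0 n)) -/(p n).
  rewrite Gamma_Re_gt0; last by rewrite -pqE Re_add addr_gt0.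
  have qN0 := Gamma_integral_neq0 (q0 m n).
  have pqN0 : Gamma_integral (d1 + (a3 * m%:R + b3 * n%:R)%:C) != 0.
    by apply: Gamma_integral_neq0; rewrite -pqE Re_add addr_gt0.
  (* d2 + a4 m and d3 + b4 n may be poles, where Gamma is 0 by convention:
     the inverses of these two values stay inside u and v *)
  rewrite /C; set u := x ^+ m / _; set v := y ^+ n / _.
  by field; rewrite pqN0 G3N0 qN0.
have [K K0 hK] := beta_mass_le hg3 q00.
have [M hM] := abs_summable2_bound hD1.
have [cF [cl1 cl2]] : cintegrable D F /\
    ccvg (square_sum (fun m n => cintegral D (f m n))) (cintegral D F).
  apply: (@ccvg_cintegral_series _ D f F (K * Normc.normc (Gamma_integral g3) * M)) => //.
  - move=> m n; apply: cmeasurableM; first exact: cmeasurable_cst.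
    exact: cmeasurable_beta_kernel.
  - move=> N.
    apply: (@le_trans _ _ (K * Normc.normc (Gamma_integral g3) *
      square_sum (fun m n => Normc.normc
        (D1_term g1 a1 b1 g2 a2 g3 b2 d1 a3 b3 d2 a4 d3 b4 x y m n)) N)%:E).
      rewrite /square_sum mulr_sumr -sumEFin; apply: lee_sum => m _.
      rewrite mulr_sumr -sumEFin; apply: lee_sum => n _.
      rewrite -mulrA -Normc.normcM -If IfB Normc.normcM mulrCA.
      have mb := measurable_normc (cmeasurable_beta_kernel (p n) (q m n)).
      apply: (@le_trans _ _ ((Normc.normc (C m n / Gamma_integral (q m n)))%:E *
        beta_mass (p n) (q m n))%E).
        rewrite -ge0_integralZl_EFin ?normc_ge0//; last 2 first.
        - by move=> t _; rewrite lee_fin normc_ge0.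
        - exact/measurable_EFinP.
        have fnE t : (Normc.normc (f m n t))%:E =
            ((Normc.normc (C m n / Gamma_integral (q m n)))%:E *
            (Normc.normc (beta_kernel (p n) (q m n) t))%:E)%E.
          by rewrite /f Normc.normcM EFinM.
        under [X in (X <= _)%E]eq_integral do rewrite fnE.
        apply: ge0_subset_integral => //.
        - by apply: measurable_funeM; exact/measurable_EFinP.
        - by move=> t _; rewrite mule_ge0 ?lee_fin ?normc_ge0.
      by rewrite EFinM lee_wpmul2l ?lee_fin ?normc_ge0//; exact: hK.
    by rewrite lee_fin ler_wpM2l// mulr_ge0 ?normc_ge0// ltW.
  - move=> t Dt; have t01 : 0 < t < 1 by move: Dt; rewrite /D /= in_itv.
    rewrite (_ : square_sum _ = fun N => cpow t (g3 - 1) * cpow (1 - t) (d1 - g3 - 1) *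
      square_sum (E2_term g1 a1 b1 g2 a2 (d1 - g3) a3 (b3 - b2) d2 a4 d3 b4
        (x * ((1 - t) `^ a3)%:C)
        (y * (t `^ b2)%:C * ((1 - t) `^ (b3 - b2))%:C)) N).
      exact/ccvgZ/abs_summable2_ccvg/hE2.
    apply/funext => N; rewrite /square_sum mulr_sumr; apply: eq_bigr => m _.
    by rewrite mulr_sumr; apply: eq_bigr => n _; rewrite (fE t Dt).
split => //; rewrite G3.
apply: series2_ccvg.
rewrite (_ : square_sum _ = fun N => (Gamma_integral g3)^-1 *
  square_sum (fun m n => cintegral D (f m n)) N); first exact: ccvgZ.
apply/funext => N; rewrite /square_sum mulr_sumr; apply: eq_bigr => m _.
by rewrite mulr_sumr; apply: eq_bigr => n _; rewrite If mulKf.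
Qed.
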